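(* Let $\Omega\subseteq\mathbb{H}$ be a non-empty circular domain and $f,g\in\mathcal{SR}(\Omega)$. If $f_v$ and $g_v$ are linearly dependent over $\mathcal{SR}_{\mathbb{R}}(\Omega)$, then $$\exp_*(f+g)=\exp_*(f)*\exp_*(g).$$ In particular, this equality holds if either $f$ or $g$ belongs to $\mathcal{SR}_{\mathbb{R}}(\Omega)$.
   Context: $\mathbb{H}$ is the algebra of quaternions (with the Euclidean topology of $\mathbb{R}^4$), with conjugation $q\mapsto q^c$, and $\mathbb{S}=\{q\in\mathbb{H}: q^2=-1\}$. For $D\subseteq\mathbb{C}=\{\alpha+\imath\beta:\alpha,\beta\in\mathbb{R}\}$ invariant under complex conjugation, $\Omega_D=\{\alpha+\beta I:\alpha+\imath\beta\in D,\ I\in\mathbb{S}\}$; sets of this form are called circular, and a circular domain is a connected open circular subset of $\mathbb{H}$. A stem function is $F=F_1+\imath F_2:D\to\mathbb{H}\otimes_{\mathbb{R}}\mathbb{C}$ ($F_1,F_2$ $\mathbb{H}$-valued) with $F(\overline z)=\overline{F(z)}$, where $\overline{p+\imath q}=p-\imath q$. It induces the slice function $f=\mathcal{I}(F):\Omega_D\to\mathbb{H}$, $f(\alpha+\beta I)=F_1(\alpha+\imath\beta)+I F_2(\alpha+\imath\beta)$. On a circular domain $\Omega=\Omega_D$, $f=\mathcal I(F)$ is slice-regular if $F$ is holomorphic for the natural complex structures of $\mathbb{C}$ and $\mathbb{H}\otimes_{\mathbb{R}}\mathbb{C}$; $\mathcal{SR}(\Omega)$ is the set of slice-regular functions, and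 $\mathcal{SR}_{\mathbb{R}}(\Omega)$ is the subset of slice-preserving ones, i.e. those with $F_1,F_2$ real-valued. The $*$-product is $\mathcal I(F)*\mathcal I(G)=\mathcal I(FG)$, with $(p+\imath q)(p'+\imath q')=pp'-qq'+\imath(pq'+qp')$; if one factor is slice-preserving it is the pointwise product. For $f=\mathcal I(F_1+\imath F_2)\in\mathcal{SR}(\Omega)$: $f^c=\mathcal I(F_1^c+\imath F_2^c)$ and $f_v=\frac{f-f^c}{2}$. Linear dependence of $f_v,g_v$ over $\mathcal{SR}_{\mathbb{R}}(\Omega)$ means that there exist $\alpha,\beta\in\mathcal{SR}_{\mathbb{R}}(\Omega)$, not both identically zero, with $\alpha f_v+\beta g_v\equiv0$. The $*$-exponential is $\exp_*(f)=\sum_{n\in\mathbb{N}}\frac{f^{*n}}{n!}$ ($f^{*n}$ the $n$-th $*$-power, $f^{*0}=1$), which converges uniformly on compact subsets of $\Omega$ to an element of $\mathcal{SR}(\Omega)$. *)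

(* Defs.v *)
From Stdlib Require Import Reals Factorial Lra Psatz ClassicalEpsilon.
From Coquelicot Require Import Coquelicot.

Open Scope R_scope.

(** [(a, b, c, d)] is [a + b i + c j + d k].  The real vector space structure
    and the (Euclidean) topology are those of Coquelicot's products. *)
Definition H : Type := (R * R * R * R)%type.

Definition H_of_R (a : R) : H := (a, 0, 0, 0).

Definition Hmul (p q : H) : H :=
  let '(a, b, c, d) := p in
  let '(a', b', c', d') := q in
  (a * a' - b * b' - c * c' - d * d',
   a * b' + b * a' + c * d' - d * c',
   a * c' - b * d' + c * a' + d * b',
   a * d' + b * c' - c * b' + d * a').

Definition Hconj (p : H) : H := let '(a, b, c, d) := p in (a, - b, - c, - d).

Definition Hre (p : H) : R := let '(a, _, _, _) := p in a.

Definition Him (p : H) : H := let '(_, b, c, d) := p in (0, b, c, d).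

Definition Himnorm (p : H) : R :=
  let '(_, b, c, d) := p in sqrt (b ^ 2 + c ^ 2 + d ^ 2).

Definition Hreal (p : H) : Prop := exists a : R, p = H_of_R a.

Definition im_unit (J : H) : Prop := Hmul J J = H_of_R (- 1).

Definition slice_pt (a b : R) (J : H) : H := plus (H_of_R a) (scal b J).

(** The sum of a convergent series; [Series] is total, with an unspecified
    meaning when a component diverges. *)
Definition Hseries (u : nat -> H) : H :=
  (Series (fun n => let '(a, _, _, _) := u n in a),
   Series (fun n => let '(_, b, _, _) := u n in b),
   Series (fun n => let '(_, _, c, _) := u n in c),
   Series (fun n => let '(_, _, _, d) := u n in d)).

(** The algebra H ⊗ C: [(p, q)] is [p + ı q]. *)
Definition HC : Type := (H * H)%type.

Definition HCmul (w w' : HC) : HC :=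
  let '(p, q) := w in
  let '(p', q') := w' in
  (minus (Hmul p p') (Hmul q q'), plus (Hmul p q') (Hmul q p')).

Definition HCbar (w : HC) : HC := let '(p, q) := w in (p, opp q).

(** The identification of [HC] with C^4, in the basis [1, i, j, k], which
    carries its complex structure. *)
Definition HC_coords (w : HC) : C * C * C * C :=
  let '((a, b, c, d), (a', b', c', d')) := w in
  ((a, a'), (b, b'), (c, c'), (d, d')).

Definition conj_invariant (D : C -> Prop) : Prop :=
  forall z : C, D z -> D (Cconj z).

Definition Omega (D : C -> Prop) (q : H) : Prop :=
  exists (a b : R) (J : H), D (a, b) /\ im_unit J /\ q = slice_pt a b J.

Definition connected {T : UniformSpace} (A : T -> Prop) : Prop :=
  forall U V : T -> Prop, open U -> open V ->
    (forall x, A x -> U x \/ V x) ->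
    (exists x, A x /\ U x) -> (exists x, A x /\ V x) ->
    exists x, A x /\ U x /\ V x.

(** [Omega D] is a circular domain; [D] is determined by [Omega D]. *)
Definition circular_domain (D : C -> Prop) : Prop :=
  conj_invariant D /\ open (Omega D) /\ connected (Omega D).

(** Functions on [D] or on [Omega D] are represented by total functions whose
    values elsewhere are irrelevant. *)

Definition stem (D : C -> Prop) (F : C -> HC) : Prop :=
  forall z : C, D z -> F (Cconj z) = HCbar (F z).

Definition holomorphic (D : C -> Prop) (F : C -> HC) : Prop :=
  forall z : C, D z -> ex_derive (fun x : C => HC_coords (F x)) z.

Definition induces (D : C -> Prop) (F : C -> HC) (f : H -> H) : Prop :=
  forall (a b : R) (J : H), D (a, b) -> im_unit J ->
    f (slice_pt a b J) = plus (fst (F (a, b))) (Hmul J (snd (F (a, b)))).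

(** The slice function I(F): a quaternion [q] is written as
    [Hre q + Himnorm q * J] with [J = Him q / Himnorm q].  At real points
    [Him q] is 0, and the value is F_1(q), as it should be because F_2 vanishes
    on the real axis.  See [induces_slice]. *)
Definition slice (F : C -> HC) (q : H) : H :=
  let w := F (Hre q, Himnorm q) in
  plus (fst w) (Hmul (scal (/ Himnorm q) (Him q)) (snd w)).

(** The stem function inducing the slice function [f]; it is unique on [D] by
    [stem_unique]. *)
Definition stem_of (D : C -> Prop) (f : H -> H) : C -> HC :=
  epsilon (inhabits (fun _ : C => (zero, zero) : HC))
    (fun F => stem D F /\ induces D F f).

Definition slice_regular (D : C -> Prop) (f : H -> H) : Prop :=
  exists F : C -> HC, stem D F /\ holomorphic D F /\ induces D F f.

Definition slice_preserving (D : C -> Prop) (f : H -> H) : Prop :=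
  exists F : C -> HC, stem D F /\ holomorphic D F /\ induces D F f /\
    forall z : C, D z -> Hreal (fst (F z)) /\ Hreal (snd (F z)).

Definition sadd (f g : H -> H) : H -> H := fun q => plus (f q) (g q).

Definition star (D : C -> Prop) (f g : H -> H) : H -> H :=
  slice (fun z => HCmul (stem_of D f z) (stem_of D g z)).

Definition sconj (D : C -> Prop) (f : H -> H) : H -> H :=
  slice (fun z => (Hconj (fst (stem_of D f z)), Hconj (snd (stem_of D f z)))).

Definition svec (D : C -> Prop) (f : H -> H) : H -> H :=
  fun q => scal (/ 2) (minus (f q) (sconj D f q)).

Fixpoint star_pow (D : C -> Prop) (f : H -> H) (n : nat) : H -> H :=
  match n with
  | O => fun _ => H_of_R 1
  | S m => star D f (star_pow D f m)
  end.

Definition exp_star (D : C -> Prop) (f : H -> H) : H -> H :=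
  fun q => Hseries (fun n => scal (/ INR (fact n)) (star_pow D f n q)).

(** The *-product with a slice-preserving function is the pointwise product,
    which is the one used here. *)
Definition sp_dependent (D : C -> Prop) (u v : H -> H) : Prop :=
  exists alpha beta : H -> H,
    slice_preserving D alpha /\ slice_preserving D beta /\
    ~ ((forall q, Omega D q -> alpha q = zero) /\
       (forall q, Omega D q -> beta q = zero)) /\
    forall q, Omega D q ->
      plus (Hmul (alpha q) (u q)) (Hmul (beta q) (v q)) = zero.

Lemma HplusE (a b c d a' b' c' d' : R) :
  plus ((a, b, c, d) : H) (a', b', c', d') = (a + a', b + b', c + c', d + d').
Proof. reflexivity. Qed.

Lemma HoppE (a b c d : R) : opp ((a, b, c, d) : H) = (- a, - b, - c, - d).
Proof. reflexivity. Qed.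

Lemma HscalE (x a b c d : R) :
  scal x ((a, b, c, d) : H) = (x * a, x * b, x * c, x * d).
Proof. reflexivity. Qed.

Lemma H_eq (a b c d a' b' c' d' : R) :
  a = a' -> b = b' -> c = c' -> d = d' -> (a, b, c, d) = (a', b', c', d') :> H.
Proof. now intros -> -> -> ->. Qed.

Lemma im_unitE (J : H) :
  im_unit J -> exists b c d : R, J = (0, b, c, d) /\ b ^ 2 + c ^ 2 + d ^ 2 = 1.
Proof.
destruct J as [[[a b] c] d]; unfold im_unit, Hmul, H_of_R.
intros [= E0 E1 E2 E3].
assert (b0 : a * b = 0) by lra.
assert (c0 : a * c = 0) by lra.
assert (d0 : a * d = 0) by lra.
assert (a0 : a * (a * a + 1) = 0).
{ replace (a * a + 1) with (b * b + c * c + d * d) by lra.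
  replace (_ * _) with (a * b * b + a * c * c + a * d * d) by ring.
  rewrite b0, c0, d0; ring. }
assert (a = 0) as -> by nra.
exists b, c, d; split; [reflexivity | nra].
Qed.

Lemma stem_unique (D : C -> Prop) (F G : C -> HC) (f : H -> H) :
  induces D F f -> induces D G f -> forall z : C, D z -> F z = G z.
Proof.
intros hF hG [a b] Dz.
assert (u1 : im_unit (0, 1, 0, 0)) by (unfold im_unit, Hmul, H_of_R; f_equal; [f_equal; [f_equal |] |]; ring).
assert (u2 : im_unit (0, -1, 0, 0)) by (unfold im_unit, Hmul, H_of_R; f_equal; [f_equal; [f_equal |] |]; ring).
pose proof (eq_trans (eq_sym (hF _ _ _ Dz u1)) (hG _ _ _ Dz u1)) as e1.
pose proof (eq_trans (eq_sym (hF _ _ _ Dz u2)) (hG _ _ _ Dz u2)) as e2.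
destruct (F (a, b)) as [[[[p0 p1] p2] p3] [[[q0 q1] q2] q3]].
destruct (G (a, b)) as [[[[r0 r1] r2] r3] [[[s0 s1] s2] s3]].
cbn [fst snd Hmul] in e1, e2; rewrite !HplusE in e1, e2.
injection e1 as; injection e2 as; f_equal; apply H_eq; lra.
Qed.

Lemma induces_slice (D : C -> Prop) (F : C -> HC) :
  conj_invariant D -> stem D F -> induces D F (slice F).
Proof.
intros cD sF a b J Dz hJ.
destruct (im_unitE J hJ) as (x & y & z & -> & n1).
assert (E : slice_pt a b (0, x, y, z) = (a, b * x, b * y, b * z)).
{ unfold slice_pt, H_of_R; rewrite HscalE, HplusE; apply H_eq; ring. }
assert (En : sqrt ((b * x) ^ 2 + (b * y) ^ 2 + (b * z) ^ 2) = Rabs b).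
{ replace (_ + _ + _) with (Rsqr b * (x ^ 2 + y ^ 2 + z ^ 2))
    by (unfold Rsqr; ring).
  now rewrite n1, Rmult_1_r, sqrt_Rsqr_abs. }
rewrite E; unfold slice; cbn [Hre Him Himnorm]; rewrite En, HscalE.
pose proof (sF _ Dz) as Ec; unfold Cconj in Ec; cbn [fst snd] in Ec.
destruct (Rtotal_order b 0) as [lt | [-> | gt]].
- rewrite (Rabs_left b lt), Ec.
  destruct (F (a, b)) as [[[[p0 p1] p2] p3] [[[q0 q1] q2] q3]].
  cbn [fst snd HCbar]; rewrite HoppE; cbn [Hmul]; rewrite !HplusE.
  apply H_eq; field; lra.
- rewrite Rabs_R0; rewrite Ropp_0 in Ec.
  destruct (F (a, 0)) as [[[[p0 p1] p2] p3] [[[q0 q1] q2] q3]].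
  cbn [HCbar] in Ec; rewrite HoppE in Ec; injection Ec as.
  assert (q0 = 0) as -> by lra; assert (q1 = 0) as -> by lra.
  assert (q2 = 0) as -> by lra; assert (q3 = 0) as -> by lra.
  cbn [fst snd Hmul]; rewrite !HplusE; apply H_eq; ring.
- rewrite (Rabs_pos_eq b) by lra.
  destruct (F (a, b)) as [[[[p0 p1] p2] p3] [[[q0 q1] q2] q3]].
  cbn [fst snd Hmul]; rewrite !HplusE.
  apply H_eq; field; lra.
Qed.

Lemma stem_of_spec (D : C -> Prop) (F : C -> HC) (f : H -> H) :
  stem D F -> induces D F f -> forall z : C, D z -> stem_of D f z = F z.
Proof.
intros sF iF.
apply (stem_unique D _ _ f); [| exact iF].
exact (proj2 (epsilon_spec _ (fun F => stem D F /\ induces D F f)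
                (ex_intro _ F (conj sF iF)))).
Qed.

(* Main.v *)
Require Import Defs.
From Stdlib Require Import Reals Factorial Lra Lia Psatz ClassicalEpsilon.
From Coquelicot Require Import Coquelicot.

(** A slice function is determined by its stem function, and sums, *-products
    and *-exponentials of slice functions are induced by the pointwise
    operations of the algebra [HC] on the stem functions ([star_induced],
    [exp_star_induced]).  The equation thus reduces to
    [exp (u + v) = exp u * exp v] in [HC] for [u = F z], [v = G z], which holds
    as soon as [u] and [v] commute ([HCexp_plus]), by the binomial theorem and
    the Cauchy product of absolutely convergent series.  When one of the
    functions is slice-preserving, its stem function has central values.

    In the dependent case, [HC] is identified with [C^4].  A relation
    [alpha f_v + beta g_v = 0] becomes [a f_i + b g_i = 0] for the three complex
    vector coordinates, with holomorphic [a] and [b].  The commutator of [F z]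
    and [G z] is given by the minors [f_i g_j - f_j g_i], which are annihilated
    by [a z] and [b z].  This says nothing at the common zeros of [a] and [b], so
    there the commutator has to vanish for another reason: a product of
    holomorphic functions is zero only if one of the factors is
    ([holomorphic_zero_divisor]).

    This last fact is the unique continuation of holomorphic functions across
    the connected set [Omega D].  Since holomorphic only means complex
    differentiable at each point, it rests on Goursat's theorem for rectangles
    ([goursat]).  In the logarithmic coordinate [w] of [z = z0 + zeta * exp w],
    that theorem shows that the mean over circles of a function holomorphic in
    an annulus does not depend on the radius.  Applied to the product of [f]
    with its reflection in a circle around [z0], it gives that the mean of
    [|f|^2] over this circle equals an integral in which one factor is evaluated
    on a small circle, where [f] vanishes ([vanishing_extends]).  So [f] vanishes
    on larger and larger discs ([vanishing_ball]). *)

(** * Goursat's theorem for rectangles *)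

Lemma nested_intervals (a b : nat -> R) :
  (forall n, a n <= a (S n)) -> (forall n, b (S n) <= b n) ->
  (forall n, a n <= b n) ->
  exists u, forall n, a n <= u <= b n.
Proof.
intros ha hb hab.
assert (ma : forall n k, a n <= a (n + k)%nat).
{ intros n k; induction k as [| k IH]; [rewrite Nat.add_0_r; lra |].
  rewrite Nat.add_succ_r; specialize (ha (n + k)%nat); lra. }
assert (mb : forall n k, b (n + k)%nat <= b n).
{ intros n k; induction k as [| k IH]; [rewrite Nat.add_0_r; lra |].
  rewrite Nat.add_succ_r; specialize (hb (n + k)%nat); lra. }
assert (ab : forall n m, a n <= b m).
{ intros n m; apply Rle_trans with (a (n + m)%nat); [apply ma |].
  apply Rle_trans with (b (n + m)%nat); [apply hab |].
  rewrite Nat.add_comm; apply mb. }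
destruct (completeness (fun x => exists n, x = a n)) as [u [up least]].
- exists (b O); intros x [n ->]; apply ab.
- exists (a O), O; reflexivity.
- exists u; intros n; split; [apply up; now exists n |].
  apply least; intros x [m ->]; apply ab.
Qed.

(** Chooses, for a box in which [P] fails, the corner of one of its four quarters
    in which [P] still fails; [h] is the scale of the quarters. *)
Definition box_corner (P : R -> R -> R -> Prop) (L M h : R) (c : R * R) : R * R :=
  epsilon (inhabits c) (fun c' =>
    (fst c' = fst c \/ fst c' = fst c + h * L) /\
    (snd c' = snd c \/ snd c' = snd c + h * M) /\
    ~ P (fst c') (snd c') h).

(** The induction behind Goursat's argument, for boxes of a fixed shape
    [L] by [M] and variable scale [h].  If [P] failed at scale 1, repeated
    quartering would give nested boxes where it fails; they shrink to a point,
    and near that point [P] holds. *)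
Lemma box_bisection (P : R -> R -> R -> Prop) (L M x0 y0 : R) :
  0 <= L -> 0 <= M ->
  (forall x y h, 0 < h ->
     P x y h -> P (x + h * L) y h -> P x (y + h * M) h ->
     P (x + h * L) (y + h * M) h -> P x y (2 * h)) ->
  (forall u v, x0 <= u <= x0 + L -> y0 <= v <= y0 + M ->
     exists d, 0 < d /\ forall x y h, 0 < h < d ->
       x <= u <= x + h * L -> y <= v <= y + h * M -> P x y h) ->
  P x0 y0 1.
Proof.
intros L0 M0 glue local.
apply NNPP; intros bad.
set (s := fix s n := match n with
          | O => (x0, y0)
          | S n => box_corner P L M ((/ 2) ^ S n) (s n)
          end).
assert (hpos : forall n, 0 < (/ 2) ^ n) by (intros n; apply pow_lt; lra).
assert (step : forall n, ~ P (fst (s n)) (snd (s n)) ((/ 2) ^ n) ->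
  (fst (s (S n)) = fst (s n) \/ fst (s (S n)) = fst (s n) + (/ 2) ^ S n * L) /\
  (snd (s (S n)) = snd (s n) \/ snd (s (S n)) = snd (s n) + (/ 2) ^ S n * M) /\
  ~ P (fst (s (S n))) (snd (s (S n))) ((/ 2) ^ S n)).
{ intros n nP.
  change (s (S n)) with (box_corner P L M ((/ 2) ^ S n) (s n)).
  unfold box_corner; apply epsilon_spec.
  apply NNPP; intros none; apply nP.
  replace ((/ 2) ^ n) with (2 * (/ 2) ^ S n) by (simpl; lra).
  assert (all : forall c', (fst c' = fst (s n) \/ fst c' = fst (s n) + (/ 2) ^ S n * L) ->
    (snd c' = snd (s n) \/ snd c' = snd (s n) + (/ 2) ^ S n * M) ->
    P (fst c') (snd c') ((/ 2) ^ S n)).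
  { intros c' h1 h2; apply NNPP; intros nP'; apply none; now exists c'. }
  apply glue; [apply hpos | ..].
  - apply (all (_, _)); simpl; tauto.
  - apply (all (_, _)); simpl; tauto.
  - apply (all (_, _)); simpl; tauto.
  - apply (all (_, _)); simpl; tauto. }
assert (nP : forall n, ~ P (fst (s n)) (snd (s n)) ((/ 2) ^ n)).
{ induction n as [| n IH]; [exact bad | apply (step n IH)]. }
assert (hL : forall n, 0 <= (/ 2) ^ n * L)
  by (intros n; apply Rmult_le_pos; [left; apply hpos | lra]).
assert (hM : forall n, 0 <= (/ 2) ^ n * M)
  by (intros n; apply Rmult_le_pos; [left; apply hpos | lra]).
assert (half : forall n K, (/ 2) ^ n * K = 2 * ((/ 2) ^ S n * K)) by (intros n K; simpl; lra).
destruct (nested_intervals (fun n => fst (s n)) (fun n => fst (s n) + (/ 2) ^ n * L))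
  as [u hu].
1-3: intros n; pose proof (hL n); pose proof (hL (S n)); pose proof (half n L);
     destruct (step n (nP n)) as [[e | e] _]; lra.
destruct (nested_intervals (fun n => snd (s n)) (fun n => snd (s n) + (/ 2) ^ n * M))
  as [v hv].
1-3: intros n; pose proof (hM n); pose proof (hM (S n)); pose proof (half n M);
     destruct (step n (nP n)) as [_ [[e | e] _]]; lra.
destruct (local u v) as (d & d0 & hd).
- generalize (hu O); simpl; lra.
- generalize (hv O); simpl; lra.
- destruct (pow_lt_1_zero (/ 2)) with (y := d) as [N hN]; [rewrite Rabs_pos_eq; lra | lra |].
  apply (nP N), hd; [| apply hu | apply hv].
  specialize (hN N (le_n N)); rewrite Rabs_pos_eq in hN by (left; apply hpos).
  split; [apply hpos | exact hN].
Qed.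

(** The integral of [p dx + q dy] along the boundary of [[a, b] * [c, d]],
    counterclockwise, with opposite sides grouped so that only differences of
    values on the two sides are integrated. *)
Definition circulation (p q : R -> R -> R) (a b c d : R) : R :=
  RInt (fun x => p x c - p x d) a b + RInt (fun y => q b y - q a y) c d.

Lemma RInt_near_const (f : R -> R) (a b k e : R) :
  a <= b -> ex_RInt f a b -> (forall x, a <= x <= b -> Rabs (f x - k) <= e) ->
  Rabs (RInt f a b - (b - a) * k) <= (b - a) * e.
Proof.
intros ab ef hf.
replace ((b - a) * k) with (RInt (fun _ => k) a b) by now rewrite RInt_const.
rewrite <- (RInt_minus f (fun _ => k)); [| exact ef | apply ex_RInt_const].
apply abs_RInt_le_const; [exact ab | apply (ex_RInt_minus f); [exact ef | apply ex_RInt_const] |].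
exact hf.
Qed.

Lemma differentiable_pt_lim_ball (p : R -> R -> R) (x y lx ly e : R) :
  differentiable_pt_lim p x y lx ly -> 0 < e ->
  exists d, 0 < d /\ forall u v, Rabs (u - x) < d -> Rabs (v - y) < d ->
    Rabs (p u v - p x y - (lx * (u - x) + ly * (v - y)))
      <= e * (Rabs (u - x) + Rabs (v - y)).
Proof.
intros dp e0; destruct (dp (mkposreal e e0)) as [[d d0] hd]; cbn [pos] in hd.
exists d; split; [exact d0 |]; intros u v hu hv.
apply Rle_trans with (1 := hd u v hu hv).
apply Rmult_le_compat_l; [lra |].
pose proof (Rabs_pos (u - x)); pose proof (Rabs_pos (v - y)).
apply Rmax_lub; lra.
Qed.

Lemma differentiable_pt_lim_continuous (p : R -> R -> R) (x y lx ly : R) :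
  differentiable_pt_lim p x y lx ly ->
  continuous (fun u => p u y) x /\ continuous (fun v => p x v) y.
Proof.
intros dp.
destruct (differentiable_pt_lim_ball _ _ _ _ _ 1 dp Rlt_0_1) as (d & d0 & hd).
set (K := 1 + Rabs lx + Rabs ly).
assert (K0 : 1 <= K) by (unfold K; pose proof (Rabs_pos lx); pose proof (Rabs_pos ly); lra).
assert (est : forall (g : R -> R) l t, Rabs l <= K - 1 ->
  (forall u, Rabs (u - t) < d -> Rabs (g u - g t - l * (u - t)) <= Rabs (u - t)) ->
  continuous g t).
{ intros g l t hl hg; apply continuity_pt_filterlim.
  intros e e0; exists (Rmin d (e / K)); split.
  - apply Rmin_glb_lt; [exact d0 | apply Rdiv_lt_0_compat; lra].
  - intros u [_ hu]; simpl in *; unfold R_dist in *.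
    assert (h1 : Rabs (u - t) < d) by (apply Rlt_le_trans with (1 := hu), Rmin_l).
    assert (h2 : Rabs (u - t) < e / K) by (apply Rlt_le_trans with (1 := hu), Rmin_r).
    specialize (hg u h1).
    replace (g u - g t) with ((g u - g t - l * (u - t)) + l * (u - t)) by ring.
    eapply Rle_lt_trans; [apply Rabs_triang |]; rewrite Rabs_mult.
    pose proof (Rabs_pos (u - t)).
    apply Rle_lt_trans with (K * Rabs (u - t)); [nra |].
    replace e with (K * (e / K)) by (field; lra).
    apply Rmult_lt_compat_l; lra. }
split.
- apply (est (fun u => p u y) lx x); [unfold K; pose proof (Rabs_pos ly); lra |].
  intros u hu; specialize (hd u y hu).
  rewrite Rminus_eq_0, Rabs_R0 in hd; specialize (hd d0).
  replace (_ - _) with (p u y - p x y - (lx * (u - x) + ly * 0)) by ring; lra.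
- apply (est (fun v => p x v) ly y); [unfold K; pose proof (Rabs_pos lx); lra |].
  intros v hv; specialize (hd x v).
  rewrite Rminus_eq_0, Rabs_R0 in hd; specialize (hd d0 hv).
  replace (_ - _) with (p x v - p x y - (lx * 0 + ly * (v - y))) by ring; lra.
Qed.

(** The form [p dx + q dy] is closed in the pointwise sense: [p] and [q] are
    differentiable at each point and [k] is the common value of [dp/dy] and
    [dq/dx]. *)
Definition closed_form (p q : R -> R -> R) (a b c d : R) : Prop :=
  forall x y, a <= x <= b -> c <= y <= d ->
  exists px k qy, differentiable_pt_lim p x y px k /\ differentiable_pt_lim q x y k qy.

Lemma closed_form_ex_RInt_x (p q : R -> R -> R) (a b c d : R) (x1 x2 y : R) :
  closed_form p q a b c d ->
  a <= x1 -> x1 <= x2 -> x2 <= b -> c <= y <= d ->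
  ex_RInt (fun x => p x y) x1 x2.
Proof.
intros closed h1 h2 h3 hy; apply (ex_RInt_continuous (V := R_CompleteNormedModule)).
rewrite Rmin_left, Rmax_right by lra; intros x hx.
destruct (closed x y) as (px & k & qy & dp & _); [lra | lra |].
apply (differentiable_pt_lim_continuous _ _ _ _ _ dp).
Qed.

Lemma closed_form_ex_RInt_y (p q : R -> R -> R) (a b c d : R) (x y1 y2 : R) :
  closed_form p q a b c d ->
  c <= y1 -> y1 <= y2 -> y2 <= d -> a <= x <= b ->
  ex_RInt (fun y => q x y) y1 y2.
Proof.
intros closed h1 h2 h3 hy; apply (ex_RInt_continuous (V := R_CompleteNormedModule)).
rewrite Rmin_left, Rmax_right by lra; intros y hx.
destruct (closed x y) as (px & k & qy & _ & dp); [lra | lra |].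
apply (differentiable_pt_lim_continuous _ _ _ _ _ dp).
Qed.

Lemma circulationE (p q : R -> R -> R) (a b c d : R) (x1 x2 y1 y2 : R) :
  closed_form p q a b c d ->
  a <= x1 -> x1 <= x2 -> x2 <= b -> c <= y1 -> y1 <= y2 -> y2 <= d ->
  circulation p q x1 x2 y1 y2 =
  RInt (fun x => p x y1) x1 x2 - RInt (fun x => p x y2) x1 x2
  + (RInt (fun y => q x2 y) y1 y2 - RInt (fun y => q x1 y) y1 y2).
Proof.
intros closed **; unfold circulation.
rewrite (RInt_minus (fun x => p x y1) (fun x => p x y2)) 
  by (apply (closed_form_ex_RInt_x p q a b c d _ _ _ closed); lra).
rewrite (RInt_minus (fun y => q x2 y) (fun y => q x1 y)) 
  by (apply (closed_form_ex_RInt_y p q a b c d _ _ _ closed); lra).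
reflexivity.
Qed.

Lemma circulation_split (p q : R -> R -> R) (a b c d : R) (x1 x2 x3 y1 y2 y3 : R) :
  closed_form p q a b c d ->
  a <= x1 -> x1 <= x2 -> x2 <= x3 -> x3 <= b ->
  c <= y1 -> y1 <= y2 -> y2 <= y3 -> y3 <= d ->
  circulation p q x1 x3 y1 y3 =
  circulation p q x1 x2 y1 y2 + circulation p q x2 x3 y1 y2 +
  circulation p q x1 x2 y2 y3 + circulation p q x2 x3 y2 y3.
Proof.
intros closed **; rewrite !(circulationE p q a b c d) by (exact closed || lra).
assert (Sp : forall y, c <= y <= d ->
  RInt (fun x => p x y) x1 x3 = RInt (fun x => p x y) x1 x2 + RInt (fun x => p x y) x2 x3).
{ intros y hy; symmetry; apply (RInt_Chasles (fun x => p x y));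
  apply (closed_form_ex_RInt_x p q a b c d _ _ _ closed); lra. }
assert (Sq : forall x, a <= x <= b ->
  RInt (fun y => q x y) y1 y3 = RInt (fun y => q x y) y1 y2 + RInt (fun y => q x y) y2 y3).
{ intros x hx; symmetry; apply (RInt_Chasles (fun y => q x y));
  apply (closed_form_ex_RInt_y p q a b c d _ _ _ closed); lra. }
rewrite (Sp y1), (Sp y3), (Sq x1), (Sq x3) by lra; ring.
Qed.

(** The affine part of a closed form at [(u, v)] has circulation 0, so only the
    remainder contributes.  It is at most [e] times the half-perimeter at each
    boundary point, and the sides have total length twice that. *)
Lemma circulation_small (p q : R -> R -> R) (a b c d : R) (u v e : R) :
  closed_form p q a b c d ->
  a <= u <= b -> c <= v <= d -> 0 < e ->
  exists r, 0 < r /\ forall x1 x2 y1 y2,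
    a <= x1 -> x1 <= u <= x2 -> x2 <= b -> c <= y1 -> y1 <= v <= y2 -> y2 <= d ->
    x2 - x1 < r -> y2 - y1 < r ->
    Rabs (circulation p q x1 x2 y1 y2) <= 2 * e * ((x2 - x1) + (y2 - y1)) ^ 2.
Proof.
intros closed hu hv e0.
destruct (closed u v hu hv) as (px & k & qy & dp & dq).
destruct (differentiable_pt_lim_ball _ _ _ _ _ e dp e0) as (r1 & r10 & hp).
destruct (differentiable_pt_lim_ball _ _ _ _ _ e dq e0) as (r2 & r20 & hq).
exists (Rmin r1 r2); split; [now apply Rmin_glb_lt |].
intros x1 x2 y1 y2 hx1 hux hx2 hy1 hvy hy2 hlx hly.
pose proof (Rmin_l r1 r2); pose proof (Rmin_r r1 r2).
set (l := (x2 - x1) + (y2 - y1)).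
assert (near : forall x, x1 <= x <= x2 -> Rabs (x - u) <= x2 - x1)
  by (intros; apply Rabs_le; lra).
assert (near' : forall y, y1 <= y <= y2 -> Rabs (y - v) <= y2 - y1)
  by (intros; apply Rabs_le; lra).
assert (Ep : forall x y, x1 <= x <= x2 -> y1 <= y <= y2 ->
  Rabs (p x y - p u v - (px * (x - u) + k * (y - v))) <= e * l).
{ intros x y hx hy; specialize (near x hx); specialize (near' y hy).
  apply Rle_trans with (1 := hp x y ltac:(lra) ltac:(lra)).
  apply Rmult_le_compat_l; unfold l; lra. }
assert (Eq : forall x y, x1 <= x <= x2 -> y1 <= y <= y2 ->
  Rabs (q x y - q u v - (k * (x - u) + qy * (y - v))) <= e * l).
{ intros x y hx hy; specialize (near x hx); specialize (near' y hy).
  apply Rle_trans with (1 := hq x y ltac:(lra) ltac:(lra)).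
  apply Rmult_le_compat_l; unfold l; lra. }
assert (I1 : Rabs (RInt (fun x => p x y1 - p x y2) x1 x2 - (x2 - x1) * (k * (y1 - y2)))
             <= (x2 - x1) * (2 * e * l)).
{ apply RInt_near_const; [lra | apply (ex_RInt_minus (fun x => p x y1));
    apply (closed_form_ex_RInt_x p q a b c d _ _ _ closed); lra |].
  intros x hx.
  pose proof (Ep x y1 hx ltac:(lra)) as E1; pose proof (Ep x y2 hx ltac:(lra)) as E2.
  apply Rabs_le_between in E1; apply Rabs_le_between in E2; apply Rabs_le; lra. }
assert (I2 : Rabs (RInt (fun y => q x2 y - q x1 y) y1 y2 - (y2 - y1) * (k * (x2 - x1)))
             <= (y2 - y1) * (2 * e * l)).
{ apply RInt_near_const; [lra | apply (ex_RInt_minus (fun y => q x2 y));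
    apply (closed_form_ex_RInt_y p q a b c d _ _ _ closed); lra |].
  intros y hy.
  pose proof (Eq x1 y ltac:(lra) hy) as E1; pose proof (Eq x2 y ltac:(lra) hy) as E2.
  apply Rabs_le_between in E1; apply Rabs_le_between in E2; apply Rabs_le; lra. }
unfold circulation.
apply Rabs_le_between in I1; apply Rabs_le_between in I2.
apply Rabs_le; unfold l in *; lra.
Qed.

(** Circulations add up under subdivision and so do areas, so a bound of the
    circulation by an arbitrarily small multiple of the area propagates from
    small boxes, where it is [circulation_small], to the whole box. *)
Lemma goursat (p q : R -> R -> R) (a b c d : R) :
  a <= b -> c <= d -> closed_form p q a b c d -> circulation p q a b c d = 0.
Proof.
intros ab cd closed.
assert (small : forall e, 0 < e -> Rabs (circulation p q a b c d) <= e).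
{ intros e e0.
  set (L := b - a); set (M := d - c).
  set (P := fun x y h => a <= x -> x + h * L <= b -> c <= y -> y + h * M <= d ->
         Rabs (circulation p q x (x + h * L) y (y + h * M)) <= e * h ^ 2).
  enough (P a c 1) as HP.
  { unfold P in HP; rewrite !Rmult_1_l in HP.
    replace (a + L) with b in HP by (unfold L; ring).
    replace (c + M) with d in HP by (unfold M; ring).
    eapply Rle_trans; [apply HP; lra | lra]. }
  assert (L0 : 0 <= L) by (unfold L; lra); assert (M0 : 0 <= M) by (unfold M; lra).
  apply (box_bisection P L M a c L0 M0).
  - intros x y h h0 P1 P2 P3 P4 h1 h2 h3 h4.
    assert (hL : 0 <= h * L) by nra; assert (hM : 0 <= h * M) by nra.
    rewrite (circulation_split p q a b c d x (x + h * L) (x + 2 * h * L)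
      y (y + h * M) (y + 2 * h * M)) by (exact closed || lra).
    unfold P in *.
    replace (x + h * L + h * L) with (x + 2 * h * L) in * by ring.
    replace (y + h * M + h * M) with (y + 2 * h * M) in * by ring.
    specialize (P1 ltac:(lra) ltac:(lra) ltac:(lra) ltac:(lra)).
    specialize (P2 ltac:(lra) ltac:(lra) ltac:(lra) ltac:(lra)).
    specialize (P3 ltac:(lra) ltac:(lra) ltac:(lra) ltac:(lra)).
    specialize (P4 ltac:(lra) ltac:(lra) ltac:(lra) ltac:(lra)).
    apply Rabs_le_between in P1; apply Rabs_le_between in P2.
    apply Rabs_le_between in P3; apply Rabs_le_between in P4.
    apply Rabs_le; lra.
  - intros u v hu hv.
    (* The 1 in [L + M + 1] covers the degenerate box. *)
    set (K := 2 * (L + M + 1) ^ 2).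
    assert (K0 : 0 < K) by (unfold K; apply Rmult_lt_0_compat; [lra | apply pow_lt; lra]).
    destruct (circulation_small p q a b c d u v (e / K) closed) as (r & r0 & hr).
    1,2: unfold L, M in *; lra.
    { now apply Rdiv_lt_0_compat. }
    exists (r / (L + M + 1)); split; [apply Rdiv_lt_0_compat; lra |].
    intros x y h [h0 hh] hx hy h1 h2 h3 h4.
    assert (hr' : h * (L + M + 1) < r).
    { replace r with (r / (L + M + 1) * (L + M + 1)) by (field; lra).
      apply Rmult_lt_compat_r; lra. }
    assert (hL : 0 <= h * L) by nra; assert (hM : 0 <= h * M) by nra.
    eapply Rle_trans; [apply (hr x (x + h * L) y (y + h * M)); lra |].
    replace (2 * (e / K) * _) with (e * h ^ 2 * (2 * (L + M) ^ 2 / K)) by (field; lra).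
    rewrite <- (Rmult_1_r (e * h ^ 2)) at 2.
    apply Rmult_le_compat_l; [nra |].
    apply (Rmult_le_reg_r K); [exact K0 |].
    replace (2 * (L + M) ^ 2 / K * K) with (2 * (L + M) ^ 2) by (field; lra).
    unfold K; nra. }
apply Rabs_eq_0, Rle_antisym; [| apply Rabs_pos].
apply le_epsilon; intros e e0; rewrite Rplus_0_l; now apply small.
Qed.

(** * Complex derivatives and unique continuation *)

Lemma is_derive_C_iff (f : C -> C) (z l : C) :
  is_derive f z l <->
  forall e, 0 < e -> exists d, 0 < d /\ forall w : C, Cmod (w - z)%C < d ->
    (Cmod (f w - f z - (w - z) * l)%C <= e * Cmod (w - z)%C).
Proof.
split.
- intros [_ dom] e e0.
  destruct (dom z (fun P HP => HP) (mkposreal e e0)) as [d hd].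
  exists d; split; [apply cond_pos |]; intros w hw; exact (hd w hw).
- intros hd; split; [apply is_linear_scal_l |].
  intros x hx; rewrite <- (is_filter_lim_locally_unique _ _ hx).
  intros [e e0]; destruct (hd e e0) as (d & d0 & hd').
  exists (mkposreal d d0); intros w hw; exact (hd' w hw).
Qed.

(** [C] is a normed module over itself in two ways, which are not convertible:
    as an absolute ring and through its product topology.  The rules for
    products and compositions live in the first, [ex_derive] in the second. *)
Lemma is_derive_C_AbsRing (f : C -> C) (z l : C) :
  is_derive (V := AbsRing_NormedModule C_AbsRing) f z l <->
  is_derive (V := C_NormedModule) f z l.
Proof.
split; intros [_ dom]; split; try apply is_linear_scal_l; exact dom.
Qed.

(** The Cauchy-Riemann equations, for derivatives at a single point. *)
Lemma is_derive_C_differentiable (f : C -> C) (x y l1 l2 : R) :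
  is_derive f ((x, y) : C) ((l1, l2) : C) <->
  differentiable_pt_lim (fun u v => fst (f (u, v))) x y l1 (- l2) /\
  differentiable_pt_lim (fun u v => snd (f (u, v))) x y l2 l1.
Proof.
assert (rem : forall u v,
  (f (u, v) - f (x, y) - ((u, v) - (x, y)) * (l1, l2))%C =
  (fst (f (u, v)) - fst (f (x, y)) - (l1 * (u - x) + - l2 * (v - y)),
   snd (f (u, v)) - snd (f (x, y)) - (l2 * (u - x) + l1 * (v - y)))).
{ intros u v; destruct (f (u, v)) as [p q], (f (x, y)) as [p0 q0].
  unfold Cminus, Cplus, Copp, Cmult; cbn [fst snd]; f_equal; ring. }
assert (dif : forall u v, ((u, v) - (x, y))%C = (u - x, v - y)) by reflexivity.
rewrite is_derive_C_iff; split.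
- intros hd.
  assert (main : forall e : posreal, locally_2d (fun u v =>
     Cmod (f (u, v) - f (x, y) - ((u, v) - (x, y)) * (l1, l2))%C
     <= e * Rmax (Rabs (u - x)) (Rabs (v - y))) x y).
  { intros [e e0].
    destruct (hd (e / 2)) as (d & d0 & hd'); [lra |].
    assert (d0' : 0 < d / 2) by lra.
    exists (mkposreal _ d0'); cbn [pos]; intros u v hu hv.
    pose proof (Cmod_2Rmax ((u, v) - (x, y))%C) as hm.
    rewrite dif in hm; cbn [fst snd] in hm; rewrite <- dif in hm.
    set (m := Rmax _ _) in *.
    assert (0 <= m) by (unfold m; apply Rle_trans with (2 := Rmax_l _ _), Rabs_pos).
    assert (hs : sqrt 2 <= 2) by (rewrite <- (sqrt_square 2) at 2 by lra; apply sqrt_le_1; lra).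
    assert (hm' : Cmod ((u, v) - (x, y))%C <= 2 * m) by nra.
    assert (m < d / 2) by (apply Rmax_lub_lt; lra).
    eapply Rle_trans; [apply hd'; lra | nra]. }
  split; intros e; destruct (main e) as [d hd']; exists d; intros u v hu hv;
    apply Rle_trans with (2 := hd' u v hu hv); rewrite rem;
    (eapply Rle_trans; [| apply Rmax_Cmod]); [apply Rmax_l | apply Rmax_r].
- intros [h1 h2] e e0.
  assert (e0' : 0 < e / 2) by lra.
  destruct (h1 (mkposreal _ e0')) as [[d1 d10] hd1].
  destruct (h2 (mkposreal _ e0')) as [[d2 d20] hd2].
  cbn [pos] in *.
  exists (Rmin d1 d2); split; [now apply Rmin_glb_lt |].
  intros [u v] hw.
  pose proof (Rmax_Cmod ((u, v) - (x, y))%C) as hm.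
  rewrite rem; rewrite dif in hm; cbn [fst snd] in hm; rewrite <- dif in hm.
  pose proof (Rmax_l (Rabs (u - x)) (Rabs (v - y))).
  pose proof (Rmax_r (Rabs (u - x)) (Rabs (v - y))).
  pose proof (Rmin_l d1 d2); pose proof (Rmin_r d1 d2).
  specialize (hd1 u v ltac:(lra) ltac:(lra)); specialize (hd2 u v ltac:(lra) ltac:(lra)).
  eapply Rle_trans; [apply Cmod_2Rmax |]; cbn [fst snd].
  set (m := Rmax (Rabs (u - x)) _) in *.
  assert (hs : sqrt 2 <= 2) by (rewrite <- (sqrt_square 2) at 2 by lra; apply sqrt_le_1; lra).
  assert (hM : Rmax (Rabs (fst (f (u, v)) - fst (f (x, y)) - (l1 * (u - x) + - l2 * (v - y))))
    (Rabs (snd (f (u, v)) - snd (f (x, y)) - (l2 * (u - x) + l1 * (v - y)))) <= e / 2 * m)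
    by now apply Rmax_lub.
  set (M := Rmax (Rabs (_ - _ - _)) _) in *.
  assert (M0 : 0 <= M) by (unfold M; apply Rle_trans with (2 := Rmax_l _ _), Rabs_pos).
  apply Rle_trans with (2 * M); [now apply Rmult_le_compat_r |].
  apply Rle_trans with (e * m); [lra | apply Rmult_le_compat_l; lra].
Qed.

Definition cexp (w : C) : C := (exp (fst w) * cos (snd w), exp (fst w) * sin (snd w)).

Lemma differentiable_pt_lim_mult_sep (g h : R -> R) (x y g' h' : R) :
  derivable_pt_lim g x g' -> derivable_pt_lim h y h' ->
  differentiable_pt_lim (fun u v => g u * h v) x y (g' * h y) (g x * h').
Proof.
intros hg hh.
apply filterdiff_differentiable_pt_lim.
apply is_derive_Reals in hg; apply is_derive_Reals in hh.
eapply filterdiff_ext_lin.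
- apply (filterdiff_mult_fct (K := R_AbsRing) (U := prod_NormedModule R_AbsRing R_NormedModule R_NormedModule)
   (fun u => g (fst u)) (fun u => h (snd u)) (x, y)).
  + exact Rmult_comm.
  + apply (filterdiff_comp' fst g); [apply filterdiff_linear, is_linear_fst | exact hg].
  + apply (filterdiff_comp' snd h); [apply filterdiff_linear, is_linear_snd | exact hh].
- intros [u v]; unfold scal, plus, mult; simpl; unfold mult; simpl; ring.
Qed.

Lemma is_derive_cexp (w : C) : is_derive cexp w (cexp w).
Proof.
destruct w as [x y]; apply is_derive_C_differentiable; unfold cexp; cbn [fst snd].
rewrite Ropp_mult_distr_r; split;
  apply differentiable_pt_lim_mult_sep;
  auto using derivable_pt_lim_exp, derivable_pt_lim_sin, derivable_pt_lim_cos.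
Qed.

(** The Schwarz reflection of a holomorphic function in the imaginary axis; on
    that axis it is the complex conjugate of the function. *)
Lemma is_derive_conj_reflect (f : C -> C) (w l : C) :
  is_derive f (- Cconj w)%C l ->
  is_derive (fun v => Cconj (f (- Cconj v)%C)) w (- Cconj l)%C.
Proof.
rewrite !is_derive_C_iff; intros hf e e0.
destruct (hf e e0) as (d & d0 & hd); exists d; split; [exact d0 |].
intros v hv.
assert (E : Cmod (- Cconj v - - Cconj w)%C = Cmod (v - w)%C).
{ replace (- Cconj v - - Cconj w)%C with (- Cconj (v - w))%C
    by (unfold Cconj, Cminus, Cplus, Copp; simpl; f_equal; ring).
  now rewrite Cmod_opp, Cmod_conj. }
specialize (hd (- Cconj v)%C); rewrite E in hd; specialize (hd hv).
eapply Rle_trans; [| exact hd]; right.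
rewrite <- (Cmod_conj (_ - _ - _)%C); f_equal.
generalize (f (- Cconj v)%C) (f (- Cconj w)%C); intros [a b] [a' b'].
destruct v, w, l; unfold Cconj, Cminus, Cplus, Copp, Cmult; simpl; f_equal; ring.
Qed.

Lemma continuous_nonneg_RInt_eq_0 (g : R -> R) (a b t : R) :
  a < t < b -> (forall x, continuous g x) -> (forall x, 0 <= g x) ->
  RInt g a b = 0 -> g t = 0.
Proof.
intros ht cg pg I0.
assert (ex : forall u v, ex_RInt g u v)
  by (intros; apply (ex_RInt_continuous (V := R_CompleteNormedModule)); auto).
assert (mono : forall u v, u <= v -> 0 <= RInt g u v).
{ intros u v uv; apply RInt_ge_0; auto. }
assert (Z : forall s, a < s < b -> RInt g a s = 0).
{ intros s hs.
  pose proof (RInt_Chasles g a s b (ex _ _) (ex _ _)) as Ch.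
  unfold plus in Ch; simpl in Ch.
  pose proof (mono a s ltac:(lra)); pose proof (mono s b ltac:(lra)); lra. }
assert (D1 : is_derive (fun s => RInt g a s) t (g t)).
{ apply (is_derive_RInt (V := R_CompleteNormedModule) g _ a t); [| apply cg].
  apply filter_forall; intros s; apply (RInt_correct (V := R_CompleteNormedModule)), ex. }
assert (D2 : is_derive (fun s => RInt g a s) t 0).
{ apply (is_derive_ext_loc (fun _ => 0)); [| apply (is_derive_const (V := R_NormedModule))].
  assert (r0 : 0 < Rmin (t - a) (b - t)) by (apply Rmin_glb_lt; lra).
  exists (mkposreal _ r0); intros s hs.
  change (Rabs (s - t) < Rmin (t - a) (b - t)) in hs.
  pose proof (Rmin_l (t - a) (b - t)); pose proof (Rmin_r (t - a) (b - t)).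
  apply Rabs_lt_between in hs; symmetry; apply Z; lra. }
rewrite <- (is_derive_unique _ _ _ D1); exact (is_derive_unique _ _ _ D2).
Qed.

(** The imaginary part of the circulation of [P dz] vanishes; when [P] has the same values
    on the two horizontal sides, those sides cancel and the integrals along the
    vertical sides agree. *)
Lemma vertical_integral_constant (P : C -> C) (a b c d : R) :
  a <= b -> c <= d ->
  (forall x y, a <= x <= b -> c <= y <= d -> ex_derive P ((x, y) : C)) ->
  (forall x, P (x, c) = P (x, d)) ->
  RInt (fun y => fst (P (b, y))) c d = RInt (fun y => fst (P (a, y))) c d.
Proof.
intros ab cd hP per.
set (p := fun x y => snd (P (x, y))); set (q := fun x y => fst (P (x, y))).
assert (cl : closed_form p q a b c d).
{ intros x y hx hy; destruct (hP x y hx hy) as [[l1 l2] D].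
  apply is_derive_C_differentiable in D; exists l2, l1, (- l2); tauto. }
pose proof (goursat p q a b c d ab cd cl) as G.
rewrite (circulationE p q a b c d) in G by (exact cl || lra).
assert (E : RInt (fun x => p x c) a b = RInt (fun x => p x d) a b)
  by (unfold p; apply RInt_ext; intros x _; now rewrite per).
unfold q in G; lra.
Qed.

(** Put [zeta = z - z0] and [phi w = f (z0 + zeta * exp w)], and multiply [phi]
    by its reflection in the imaginary axis.  The product [P] is holomorphic in
    a strip around the axis and [2 i PI]-periodic, so its integral over a
    vertical period is the same on all lines of the strip.  On the axis it is
    the integral of [|phi|^2]; on the line [Re w = sigma] it is 0 as soon as
    [|zeta| * exp sigma < r].  The reflected factor needs
    [|zeta| * exp (- sigma) < rho], and both are possible precisely because
    [|zeta|^2 < r * rho].  Hence [phi] vanishes on the axis, at [w = 0] in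
    particular. *)
Lemma vanishing_extends (f : C -> C) (z0 : C) (r rho : R) :
  (forall z, Cmod (z - z0)%C < rho -> ex_derive f z) ->
  (forall z, Cmod (z - z0)%C < r -> f z = 0) ->
  forall z, Cmod (z - z0)%C < rho -> Cmod (z - z0)%C ^ 2 < r * rho -> f z = 0.
Proof.
intros df fz z hz hz2.
destruct (Rlt_le_dec (Cmod (z - z0)%C) r) as [lt | ge]; [now apply fz |].
set (zeta := (z - z0)%C) in *; set (m := Cmod zeta) in *.
assert (m0 : 0 <= m) by apply Cmod_ge_0.
assert (r0 : 0 < r) by (pose proof (pow2_ge_0 m); nra).
assert (m0' : 0 < m) by lra.
(* [k] is [exp sigma], halfway between the two bounds that it must satisfy. *)
set (k := (m / rho + r / m) / 2).
assert (hk : m < k * rho /\ k * m < r /\ 0 < k < 1).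
{ assert (A : m / rho < r / m).
  { apply (Rmult_lt_reg_r (m * rho)); [apply Rmult_lt_0_compat; lra |].
    replace (m / rho * (m * rho)) with (m ^ 2) by (field; lra).
    replace (r / m * (m * rho)) with (r * rho) by (field; lra); lra. }
  assert (B : r / m <= 1).
  { apply (Rmult_le_reg_r m); [lra |]; replace (r / m * m) with r by (field; lra); lra. }
  assert (D : 0 < m / rho) by (apply Rdiv_lt_0_compat; lra).
  repeat split; unfold k; try lra.
  - replace m with (m / rho * rho) at 1 by (field; lra); apply Rmult_lt_compat_r; lra.
  - replace r with (r / m * m) at 2 by (field; lra); apply Rmult_lt_compat_r; lra. }
destruct hk as (k1 & k2 & k3 & k4).
set (sigma := ln k).
assert (hs : sigma < 0) by (unfold sigma; rewrite <- ln_1; apply ln_increasing; lra).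
assert (es : exp sigma = k) by (apply exp_ln; lra).
set (phi := fun w : C => f (z0 + zeta * cexp w)%C).
set (P := fun w : C => (phi w * Cconj (phi (- Cconj w)))%C).
assert (modexp : forall w, Cmod (cexp w) = exp (fst w)).
{ intros [x y]; unfold cexp, Cmod; cbn [fst snd].
  replace ((exp x * cos y) ^ 2 + (exp x * sin y) ^ 2) with (exp x * exp x).
  - apply sqrt_square; left; apply exp_pos.
  - pose proof (sin2_cos2 y) as sc; unfold Rsqr in sc.
    replace (exp x * exp x) with (exp x * exp x * (sin y * sin y + cos y * cos y))
      by (rewrite sc; ring); ring. }
assert (modphi : forall w, Cmod (z0 + zeta * cexp w - z0)%C = m * exp (fst w)).
{ intros w; replace (z0 + zeta * cexp w - z0)%C with (zeta * cexp w)%C by ring.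
  now rewrite Cmod_mult, modexp. }
assert (dphi : forall w, m * exp (fst w) < rho -> exists l, is_derive phi w l).
{ intros w hw; destruct (df (z0 + zeta * cexp w)%C) as [l hl]; [now rewrite modphi |].
  eexists; apply (is_derive_comp f (fun w => (z0 + zeta * cexp w)%C)); [exact hl |].
  apply (is_derive_plus (V := AbsRing_NormedModule C_AbsRing) (fun _ => z0) (fun w => (zeta * cexp w)%C));
    [apply is_derive_const |].
  apply (is_derive_mult (fun _ => zeta) cexp);
    [apply is_derive_const | apply is_derive_C_AbsRing, is_derive_cexp | exact Cmult_comm]. }
assert (exb : forall x, sigma <= x <= - sigma -> m * exp x < rho).
{ intros x hx; apply Rle_lt_trans with (m * exp (- sigma)).
  - apply Rmult_le_compat_l; [lra |]; destruct (Req_dec x (- sigma)) as [-> | ne]; [lra |].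
    left; apply exp_increasing; lra.
  - rewrite exp_Ropp, es; apply (Rmult_lt_reg_r k); [lra |].
    replace (m * / k * k) with m by (field; lra); lra. }
assert (dP : forall x y, sigma <= x <= - sigma -> ex_derive P ((x, y) : C)).
{ intros x y hx.
  destruct (dphi (x, y)) as [l1 h1]; [now apply exb |].
  destruct (dphi (- Cconj (x, y))%C) as [l2 h2]; [apply exb; simpl; lra |].
  eexists; apply is_derive_C_AbsRing, (is_derive_mult phi (fun w => Cconj (phi (- Cconj w)%C)));
    [apply is_derive_C_AbsRing; exact h1 | | exact Cmult_comm].
  apply is_derive_C_AbsRing, is_derive_conj_reflect; exact h2. }
pose proof PI_RGT_0 as pi0.
assert (I : RInt (fun y => fst (P (0, y))) (- PI) PI = 0).
{ rewrite (vertical_integral_constant P sigma 0 (- PI) PI); [ | lra | lra | | ].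
  - rewrite (RInt_ext _ (fun _ => 0)); [rewrite RInt_const; apply Rmult_0_r |].
    intros y _; unfold P, phi; rewrite fz; [simpl; ring |].
    rewrite modphi; cbn [fst]; rewrite es; lra.
  - intros x y hx _; apply dP; lra.
  - intros x.
    assert (E : forall x, cexp (x, - PI) = cexp (x, PI))
      by (intros x'; unfold cexp; cbn [fst snd]; now rewrite cos_neg, sin_neg, sin_PI, Ropp_0).
    unfold P, phi, Cconj, Copp; cbn [fst snd]; now rewrite !Ropp_involutive, !E. }
assert (Pax : forall y, fst (P (0, y)) = fst (phi (0, y)) ^ 2 + snd (phi (0, y)) ^ 2).
{ intros y; unfold P.
  replace (- Cconj (0, y))%C with ((0, y) : C) by (unfold Cconj, Copp; simpl; f_equal; ring).
  simpl; ring. }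
assert (Z : fst (P (0, 0)) = 0).
{ apply (continuous_nonneg_RInt_eq_0 (fun y => fst (P (0, y))) (- PI) PI); [lra | | | exact I].
  - intros y; destruct (dP 0 y) as [[l1 l2] D]; [lra |].
    apply is_derive_C_differentiable in D as [D _].
    apply (differentiable_pt_lim_continuous _ _ _ _ _ D).
  - intros y; rewrite Pax; nra. }
rewrite Pax in Z.
assert (E0 : phi (0, 0) = f z).
{ unfold phi; f_equal; unfold cexp; cbn [fst snd]; rewrite exp_0, cos_0, sin_0.
  unfold zeta; destruct z, z0; unfold Cminus, Cplus, Copp, Cmult; simpl; f_equal; ring. }
rewrite E0 in Z; destruct (f z) as [u v]; cbn [fst snd] in Z.
apply injective_projections; simpl; apply Rsqr_0_uniq; unfold Rsqr;
  pose proof (pow2_ge_0 u); pose proof (pow2_ge_0 v); nra.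
Qed.

(** If [s < rho] were the largest radius of a disc where [f] vanishes,
    [vanishing_extends] would enlarge it to the geometric mean of [s] and
    [rho]. *)
Lemma vanishing_ball (f : C -> C) (z0 : C) (r rho : R) :
  0 < r ->
  (forall z, Cmod (z - z0)%C < rho -> ex_derive f z) ->
  (forall z, Cmod (z - z0)%C < r -> f z = 0) ->
  forall z, Cmod (z - z0)%C < rho -> f z = 0.
Proof.
intros r0 df fz.
set (E := fun s => s <= rho /\ forall z, Cmod (z - z0)%C < s -> f z = 0).
destruct (Rle_lt_dec rho r) as [le | lt].
{ intros z hz; apply fz; lra. }
destruct (completeness E) as [s [up least]].
- exists rho; now intros s [hs _].
- exists r; split; [lra | exact fz].
- assert (rs : r <= s) by (apply up; split; [lra | exact fz]).
  assert (sr : s <= rho) by (apply least; now intros u [hu _]).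
  assert (Es : forall z, Cmod (z - z0)%C < s -> f z = 0).
  { intros z hz; apply NNPP; intros nz.
    apply (Rlt_not_le _ _ hz), least; intros u [_ hu].
    destruct (Rle_lt_dec u (Cmod (z - z0)%C)) as [h | h]; [exact h |].
    now elim nz; apply hu. }
  destruct (Req_dec s rho) as [<- | ne]; [exact Es |].
  exfalso.
  assert (sq : s < sqrt (s * rho)).
  { rewrite <- (sqrt_square s) at 1 by lra; apply sqrt_lt_1; nra. }
  assert (sq' : sqrt (s * rho) <= rho).
  { rewrite <- (sqrt_square rho) at 2 by lra; apply sqrt_le_1; nra. }
  apply (Rlt_not_le _ _ sq), up; split; [exact sq' |].
  intros z hz; apply (vanishing_extends f z0 s rho df Es); [lra |].
  rewrite <- (pow2_sqrt (s * rho)) by nra.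
  pose proof (Cmod_ge_0 (z - z0)%C); nra.
Qed.

(** * Circular domains and products of holomorphic functions *)

(** Openness in terms of [Cmod], the norm that complex derivatives refer to. *)
Definition disc_open (A : C -> Prop) : Prop :=
  forall z, A z -> exists r, 0 < r /\ forall w, Cmod (w - z)%C < r -> A w.

Lemma Himnorm_slice_pt (a b : R) (J : H) :
  im_unit J -> Hre (slice_pt a b J) = a /\ Himnorm (slice_pt a b J) = Rabs b.
Proof.
intros hJ; destruct (im_unitE J hJ) as (x & y & z & -> & n1).
unfold slice_pt, H_of_R; rewrite HscalE, HplusE; cbn [Hre Himnorm]; split; [ring |].
replace (_ + _ + _) with (Rsqr b * (x ^ 2 + y ^ 2 + z ^ 2)) by (unfold Rsqr; ring).
now rewrite n1, Rmult_1_r, sqrt_Rsqr_abs.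
Qed.

Lemma conj_invariant_abs (D : C -> Prop) (a b : R) :
  conj_invariant D -> D (a, Rabs b) <-> D (a, b).
Proof.
intros cD; unfold Rabs; destruct (Rcase_abs b) as [_ | _]; [| tauto].
split; intros h; apply cD in h; unfold Cconj in h; cbn [fst snd] in h; [| exact h].
now rewrite Ropp_involutive in h.
Qed.

Lemma Omega_iff (D : C -> Prop) (q : H) :
  conj_invariant D -> Omega D q <-> D (Hre q, Himnorm q).
Proof.
intros cD; split.
- intros (a & b & J & Dz & hJ & ->).
  destruct (Himnorm_slice_pt a b J hJ) as [-> ->]; now apply conj_invariant_abs.
- intros Dz; destruct q as [[[a b] c] d]; cbn [Hre Himnorm] in Dz.
  set (n := sqrt (b ^ 2 + c ^ 2 + d ^ 2)) in Dz.
  assert (n2 : n * n = b ^ 2 + c ^ 2 + d ^ 2) by (apply sqrt_sqrt; nra).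
  destruct (Req_dec n 0) as [n0 | n0].
  + exists a, n, (0, 1, 0, 0); split; [exact Dz | split].
    * unfold im_unit, Hmul, H_of_R; apply H_eq; ring.
    * unfold slice_pt, H_of_R; rewrite HscalE, HplusE; rewrite n0 in *; apply H_eq; nra.
  + exists a, n, (0, b / n, c / n, d / n); split; [exact Dz | split].
    * unfold im_unit, Hmul, H_of_R; apply H_eq; try (field; exact n0).
      apply (Rmult_eq_reg_r (n * n)); [field_simplify; [nra | exact n0] |].
      now apply Rmult_integral_contrapositive_currified.
    * unfold slice_pt, H_of_R; rewrite HscalE, HplusE; apply H_eq; field; exact n0.
Qed.

(** [Omega A] is the preimage of [A] under the continuous map sending [q] to
    [(Hre q, Himnorm q)]. *)
Lemma disc_open_Omega_open (A : C -> Prop) :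
  conj_invariant A -> disc_open A -> open (Omega A).
Proof.
intros cA oA.
assert (oA' : open (A : C_UniformSpace -> Prop)).
{ intros z Az; destruct (oA z Az) as (r & r0 & hr).
  apply locally_C; exists (mkposreal r r0); intros w hw; apply hr; exact hw. }
apply (open_ext (fun q : H => A (Hre q, Himnorm q))); [intros q; now rewrite Omega_iff |].
apply (open_comp (fun q : H => (Hre q, Himnorm q) : C_UniformSpace) A); [| exact oA'].
intros q _.
assert (cb : forall q : H, continuous (fun q : H => snd (fst (fst q))) q).
{ intros q'; apply (continuous_comp (fun q : H => fst (fst q)) snd); [| apply continuous_snd].
  apply (continuous_comp (fun q : H => fst q) fst); apply continuous_fst. }
assert (cc : forall q : H, continuous (fun q : H => snd (fst q)) q).
{ intros q'; apply (continuous_comp (fun q : H => fst q) snd); [apply continuous_fst | apply continuous_snd]. }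
assert (cd : forall q : H, continuous (fun q : H => snd q) q) by (intros q'; apply continuous_snd).
assert (ca : forall q : H, continuous (fun q : H => fst (fst (fst q))) q).
{ intros q'; apply (continuous_comp (fun q : H => fst (fst q)) fst); [| apply continuous_fst].
  apply (continuous_comp (fun q : H => fst q) fst); apply continuous_fst. }
assert (sq : forall g : H -> R, continuous g q -> continuous (fun q => g q ^ 2) q).
{ intros g cg; apply (continuous_ext (fun q => mult (g q) (g q)));
    [intros q'; unfold mult; simpl; ring | now apply (continuous_mult g g)]. }
assert (cre : continuous Hre q)
  by (apply (continuous_ext (fun q : H => fst (fst (fst q)))); [now intros [[[? ?] ?] ?] | apply ca]).
assert (cim : continuous Himnorm q).
{ apply (continuous_ext (fun q : H => sqrt (plus (plus (snd (fst (fst q)) ^ 2) (snd (fst q) ^ 2)) (snd q ^ 2))));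
    [now intros [[[? ?] ?] ?] |].
  apply continuous_comp; [| apply continuous_sqrt].
  apply (continuous_plus (fun q : H => plus (snd (fst (fst q)) ^ 2) (snd (fst q) ^ 2)));
    [apply (continuous_plus (fun q : H => snd (fst (fst q)) ^ 2)) |]; apply sq; auto. }
intros P [e hP]; generalize (filterlim_pair Hre Himnorm cre cim).
intros fl; apply (fl P); exists (ball (Hre q) e) (ball (Himnorm q) e);
  [apply locally_ball | apply locally_ball | intros x y hx hy; apply hP; now split].
Qed.

(** [D] is the trace of [Omega D] on the slice spanned by 1 and i. *)
Lemma Omega_open_disc_open (D : C -> Prop) :
  conj_invariant D -> open (Omega D) -> disc_open D.
Proof.
intros cD oD [x y] Dz.
assert (flat : forall u v, Omega D (u, v, 0, 0) <-> D (u, v)).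
{ intros u v; rewrite Omega_iff by exact cD; cbn [Hre Himnorm].
  replace (v ^ 2 + 0 ^ 2 + 0 ^ 2) with (Rsqr v) by (unfold Rsqr; ring).
  rewrite sqrt_Rsqr_abs; now apply conj_invariant_abs. }
destruct (oD (x, y, 0, 0)) as [[e e0] he]; [now apply flat |].
exists e; split; [exact e0 |]; intros [u v] hw.
pose proof (Rmax_Cmod ((u, v) - (x, y))%C) as hm; simpl fst in hm; simpl snd in hm.
pose proof (Rmax_l (Rabs (u + - x)) (Rabs (v + - y))).
pose proof (Rmax_r (Rabs (u + - x)) (Rabs (v + - y))).
apply flat, he; repeat split; simpl; unfold ball; simpl;
  unfold AbsRing_ball, abs, minus, plus, opp; simpl.
1,2: lra.
all: rewrite Ropp_0, Rplus_0_r, Rabs_R0; exact e0.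
Qed.

Definition vanishes_near (a : C -> C) (z : C) : Prop :=
  exists r, 0 < r /\ forall w, Cmod (w - z)%C < r -> a w = 0.

(** Split [D] into the set [Z] of the points near which [a] vanishes and its
    complement [W].  [W] is open by unique continuation ([vanishing_ball]), and
    both sets are invariant under conjugation by the symmetry of [a], so they
    cut [Omega D] into two disjoint open sets.  [D] itself need not be
    connected, which is why the argument takes place in [Omega D].  A point
    where [a] is not 0 lies in [W]; a point where [c] is not 0 would lie in
    [Z]. *)
Lemma holomorphic_zero_divisor (D : C -> Prop) (a c : C -> C) :
  circular_domain D ->
  (forall z, D z -> ex_derive a z) -> (forall z, D z -> ex_derive c z) ->
  (forall z, D z -> a (Cconj z) = Cconj (a z)) ->
  (forall z, D z -> (a z * c z = 0)%C) ->
  (exists z, D z /\ a z <> 0) ->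
  forall z, D z -> c z = 0.
Proof.
intros (cD & oD & conD) da dc sa ac [z1 [Dz1 az1]] z2 Dz2.
apply NNPP; intros cz2.
pose proof (Omega_open_disc_open D cD oD) as dD.
set (Z := fun z => D z /\ vanishes_near a z).
set (W := fun z => D z /\ ~ vanishes_near a z).
assert (vconj : forall z, D z -> vanishes_near a z -> vanishes_near a (Cconj z)).
{ intros z Dz (r & r0 & hr); destruct (dD z Dz) as (s & s0 & hs).
  exists (Rmin r s); split; [now apply Rmin_glb_lt |]; intros w hw.
  pose proof (Rmin_l r s); pose proof (Rmin_r r s).
  assert (E : Cmod (Cconj w - z)%C = Cmod (w - Cconj z)%C).
  { rewrite <- (Cmod_conj (w - _)%C); f_equal.
    unfold Cconj, Cminus, Cplus, Copp; simpl; f_equal; ring. }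
  rewrite <- (Cconj_conj w), sa by (apply hs; lra).
  rewrite hr by lra; apply injective_projections; simpl; ring. }
assert (cZ : conj_invariant Z) by (intros z [Dz vz]; split; [now apply cD | now apply vconj]).
assert (cW : conj_invariant W).
{ intros z [Dz nz]; split; [now apply cD |]; intros vz; apply nz.
  rewrite <- (Cconj_conj z); apply vconj; [now apply cD | exact vz]. }
assert (oZ : disc_open Z).
{ intros z [Dz (r & r0 & hr)]; destruct (dD z Dz) as (s & s0 & hs).
  pose proof (Rmin_l (r / 2) s); pose proof (Rmin_r (r / 2) s).
  exists (Rmin (r / 2) s); split; [apply Rmin_glb_lt; lra |]; intros w hw; split; [apply hs; lra |].
  exists (r / 2); split; [lra |]; intros v hv; apply hr.
  replace (v - z)%C with ((v - w) + (w - z))%C by ring.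
  eapply Rle_lt_trans; [apply Cmod_triangle | lra]. }
assert (oW : disc_open W).
{ intros z [Dz nz]; destruct (dD z Dz) as (s & s0 & hs).
  (* If [a] vanished near a point [w] this close to [z], it would vanish on a
     disc around [w] that contains a neighbourhood of [z]. *)
  exists (s / 3); split; [lra |]; intros w hw; split; [apply hs; lra |].
  intros (r & r0 & hr); apply nz; exists (s / 3); split; [lra |]; intros v hv.
  apply (vanishing_ball a w r (2 * s / 3) r0); [| exact hr |].
  - intros u hu; apply da, hs.
    replace (u - z)%C with ((u - w) + (w - z))%C by ring.
    eapply Rle_lt_trans; [apply Cmod_triangle | lra].
  - replace (v - w)%C with ((v - z) + - (w - z))%C by ring.
    eapply Rle_lt_trans; [apply Cmod_triangle | rewrite Cmod_opp; lra]. }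
assert (toOmega : forall (A : C -> Prop) z, A z -> Omega A (slice_pt (fst z) (snd z) (0, 1, 0, 0))).
{ intros A [x y] Az; exists x, y, (0, 1, 0, 0); split; [exact Az | split; [| reflexivity]].
  unfold im_unit, Hmul, H_of_R; apply H_eq; ring. }
destruct (conD (Omega Z) (Omega W)) as (q & _ & qZ & qW).
- now apply disc_open_Omega_open.
- now apply disc_open_Omega_open.
- intros q Dq; apply Omega_iff in Dq; [| exact cD].
  destruct (classic (vanishes_near a (Hre q, Himnorm q))).
  + left; apply Omega_iff; [exact cZ | now split].
  + right; apply Omega_iff; [exact cW | now split].
- exists (slice_pt (fst z2) (snd z2) (0, 1, 0, 0)); split; [now apply toOmega |].
  apply toOmega; split; [exact Dz2 |].
  (* [c] is continuous at [z2], hence nonzero near it, and so [a] is 0 there. *)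
  destruct (dc z2 Dz2) as [l hl].
  destruct (proj1 (is_derive_C_iff c z2 l) hl 1 Rlt_0_1) as (r & r0 & hr).
  destruct (dD z2 Dz2) as (s & s0 & hs).
  assert (nc : 0 < Cmod (c z2)) by now apply Cmod_gt_0.
  pose proof (Cmod_ge_0 l) as l0.
  set (t := Cmod (c z2) / (1 + Cmod l)).
  assert (t0 : 0 < t) by (apply Rdiv_lt_0_compat; lra).
  exists (Rmin t (Rmin r s)); split; [now repeat apply Rmin_glb_lt |]; intros w hw.
  pose proof (Rmin_l t (Rmin r s)); pose proof (Rmin_r t (Rmin r s)).
  pose proof (Rmin_l r s); pose proof (Rmin_r r s).
  apply NNPP; intros aw.
  destruct (classic (c w = 0)) as [e | cw];
    [| exact (Cmult_neq_0 _ _ aw cw (ac w (hs w ltac:(lra))))].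
  specialize (hr w ltac:(lra)); rewrite e in hr.
  assert (le : Cmod (c z2) <= Cmod (w - z2)%C * (1 + Cmod l)).
  { replace (c z2) with (- (0 - c z2 - (w - z2) * l) + - ((w - z2) * l))%C by ring.
    eapply Rle_trans; [apply Cmod_triangle |]; rewrite !Cmod_opp, Cmod_mult; lra. }
  apply (Rle_not_lt _ _ le).
  replace (Cmod (c z2)) with (t * (1 + Cmod l)) by (unfold t; field; lra).
  apply Rmult_lt_compat_r; lra.
- exists (slice_pt (fst z1) (snd z1) (0, 1, 0, 0)); split; [now apply toOmega |].
  apply toOmega; split; [exact Dz1 |]; intros (r & r0 & hr); apply az1, hr.
  replace (z1 - z1)%C with (RtoC 0) by ring; now rewrite Cmod_0.
- apply Omega_iff in qZ; [| exact cZ]; apply Omega_iff in qW; [| exact cW].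
  now apply (proj2 qW), qZ.
Qed.

(** * The exponential in the complexified quaternions *)

Definition Hi (p : H) : R := let '(_, b, _, _) := p in b.
Definition Hj (p : H) : R := let '(_, _, c, _) := p in c.
Definition Hk (p : H) : R := let '(_, _, _, d) := p in d.

Lemma H_ext (p q : H) :
  Hre p = Hre q -> Hi p = Hi q -> Hj p = Hj q -> Hk p = Hk q -> p = q.
Proof. destruct p as [[[? ?] ?] ?], q as [[[? ?] ?] ?]; exact (H_eq _ _ _ _ _ _ _ _). Qed.

Lemma HminusE (a b c d a' b' c' d' : R) :
  minus ((a, b, c, d) : H) (a', b', c', d') = (a - a', b - b', c - c', d - d').
Proof. reflexivity. Qed.

Lemma HCplusE (p q p' q' : H) :
  plus ((p, q) : HC) (p', q') = (plus p p', plus q q').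
Proof. reflexivity. Qed.

Lemma HCscalE (x : R) (p q : H) : scal x ((p, q) : HC) = (scal x p, scal x q).
Proof. reflexivity. Qed.

Ltac HC_ring :=
  repeat match goal with
    | w : HC |- _ => destruct w
    | p : H |- _ => destruct p as [[[? ?] ?] ?]
    | p : prod _ _ |- _ => destruct p
  end;
  unfold HCmul, Hmul, HCbar;
  repeat progress
    (cbn [fst snd]; rewrite ?HCscalE, ?HCplusE, ?HscalE, ?HoppE, ?HminusE, ?HplusE);
  repeat (apply (f_equal2 pair));
  try (match goal with |- ?a = ?b => change (@eq R a b) end; ring).

Lemma HCmul_assoc (u v w : HC) : HCmul u (HCmul v w) = HCmul (HCmul u v) w.
Proof. HC_ring. Qed.

Lemma HCmul_plus_l (u v w : HC) : HCmul (plus u v) w = plus (HCmul u w) (HCmul v w).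
Proof. HC_ring. Qed.

Lemma HCmul_plus_r (u v w : HC) : HCmul u (plus v w) = plus (HCmul u v) (HCmul u w).
Proof. HC_ring. Qed.

Lemma HCmul_scal_l (x : R) (u v : HC) : HCmul (scal x u) v = scal x (HCmul u v).
Proof. HC_ring. Qed.

Lemma HCmul_scal_r (x : R) (u v : HC) : HCmul u (scal x v) = scal x (HCmul u v).
Proof. HC_ring. Qed.

Lemma HC_scal_cancel (x : R) (u v : HC) : x <> 0 -> scal x u = scal x v -> u = v.
Proof.
intros x0 e; destruct u as [[[[? ?] ?] ?] [[[? ?] ?] ?]], v as [[[[? ?] ?] ?] [[[? ?] ?] ?]].
rewrite !HCscalE, !HscalE in e; injection e as.
repeat (apply (f_equal2 pair)); apply (Rmult_eq_reg_l x); assumption.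
Qed.

Lemma HCbar_mul (u v : HC) : HCbar (HCmul u v) = HCmul (HCbar u) (HCbar v).
Proof. HC_ring. Qed.

Lemma HCmul_sum_r (u : HC) (f : nat -> HC) (n : nat) :
  HCmul u (sum_n f n) = sum_n (fun k => HCmul u (f k)) n.
Proof.
induction n as [| n IH]; [now rewrite !sum_O |].
now rewrite !sum_Sn, HCmul_plus_r, IH.
Qed.

Lemma HC_scal_plus_r (x : R) (u v : HC) : scal x (plus u v) = plus (scal x u) (scal x v).
Proof. HC_ring. Qed.

Lemma HC_scal_sum (x : R) (f : nat -> HC) (n : nat) :
  scal x (sum_n f n) = sum_n (fun k => scal x (f k)) n.
Proof.
induction n as [| n IH]; [now rewrite !sum_O |].
now rewrite !sum_Sn, HC_scal_plus_r, IH.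
Qed.

Lemma HC_scal_plus (x y : R) (u : HC) : scal (x + y) u = plus (scal x u) (scal y u).
Proof. HC_ring. Qed.

Lemma HC_scal_0 (u : HC) : scal 0 u = zero.
Proof.
change (zero : HC) with ((0, 0, 0, 0), (0, 0, 0, 0) : H); HC_ring.
Qed.

Lemma H_opp_plus (p q : H) : opp (plus p q) = plus (opp p) (opp q).
Proof. HC_ring. Qed.

Fixpoint HCpow (w : HC) (n : nat) : HC :=
  match n with
  | O => (H_of_R 1, zero)
  | S m => HCmul w (HCpow w m)
  end.

Definition HCexp_term (w : HC) (n : nat) : HC := scal (/ INR (fact n)) (HCpow w n).

Lemma HCexp_term_S (w : HC) (n : nat) :
  scal (INR (S n)) (HCexp_term w (S n)) = HCmul w (HCexp_term w n).
Proof.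
unfold HCexp_term; cbn [HCpow].
rewrite HCmul_scal_r, scal_assoc; f_equal.
change (INR (S n) * / INR (fact (S n)) = / INR (fact n)).
rewrite fact_simpl, mult_INR.
field; split; [apply INR_fact_neq_0 | apply not_0_INR; lia].
Qed.

Lemma HCexp_term_commute (u v : HC) (n : nat) :
  HCmul u v = HCmul v u -> HCmul (HCexp_term u n) v = HCmul v (HCexp_term u n).
Proof.
intros uv; unfold HCexp_term; rewrite HCmul_scal_l, HCmul_scal_r; f_equal.
induction n as [| n IH]; cbn [HCpow].
- unfold H_of_R; change (zero : H) with ((0, 0, 0, 0) : H); HC_ring.
- now rewrite <- HCmul_assoc, IH, !HCmul_assoc, uv.
Qed.

(** The binomial theorem for commuting elements, in a form without binomial
    coefficients.  Both sides satisfy the recursion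
    [(n + 1) t (n + 1) = (u + v) * t n]: on the right-hand side, write [n + 1]
    as [k + (n + 1 - k)] in the [k]-th term; the factor [k] turns the [k]-th
    term for [u] into [u] times the previous one, the factor [n + 1 - k] does
    the same for [v], and commutation brings [v] to the front. *)
Lemma HCexp_term_plus (u v : HC) (n : nat) :
  HCmul u v = HCmul v u ->
  HCexp_term (plus u v) n = sum_n (fun k => HCmul (HCexp_term u k) (HCexp_term v (n - k))) n.
Proof.
intros uv; induction n as [| n IH].
{ rewrite sum_O; unfold HCexp_term; cbn [HCpow fact Nat.sub INR].
  unfold H_of_R; change (zero : H) with ((0, 0, 0, 0) : H); HC_ring; field. }
set (t := fun k => HCmul (HCexp_term u k) (HCexp_term v (S n - k))).
change (HCexp_term (plus u v) (S n) = sum_n t (S n)).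
assert (n0 : INR (S n) <> 0) by (apply not_0_INR; lia).
apply (HC_scal_cancel _ _ _ n0).
rewrite HCexp_term_S, IH, HCmul_plus_l, !HCmul_sum_r.
rewrite HC_scal_sum.
rewrite (sum_n_ext_loc (fun k => scal (INR (S n)) (t k))
  (fun k => plus (scal (INR k) (t k)) (scal (INR (S n - k)) (t k)))).
2:{ intros k hk; rewrite <- HC_scal_plus; f_equal; rewrite <- plus_INR; f_equal; lia. }
rewrite sum_n_plus; f_equal.
- unfold sum_n; rewrite (sum_Sn_m _ 0 (S n)) by lia.
  change (INR 0) with 0; rewrite HC_scal_0, plus_zero_l.
  rewrite <- sum_n_m_S; apply sum_n_m_ext_loc; intros k _.
  unfold t; now rewrite <- HCmul_scal_l, HCexp_term_S, HCmul_assoc, Nat.sub_succ.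
- rewrite sum_Sn, Nat.sub_diag; change (INR 0) with 0.
  rewrite HC_scal_0, plus_zero_r; apply sum_n_ext_loc; intros k hk.
  unfold t; rewrite <- HCmul_scal_r, Nat.sub_succ_l, HCexp_term_S by exact hk.
  now rewrite !HCmul_assoc, HCexp_term_commute.
Qed.

Definition is_Hseries (u : nat -> H) (l : H) : Prop :=
  is_series (fun n => Hre (u n)) (Hre l) /\ is_series (fun n => Hi (u n)) (Hi l) /\
  is_series (fun n => Hj (u n)) (Hj l) /\ is_series (fun n => Hk (u n)) (Hk l).

Lemma is_Hseries_unique (u : nat -> H) (l : H) : is_Hseries u l -> Hseries u = l.
Proof.
intros (h0 & h1 & h2 & h3); apply H_ext; apply is_series_unique; assumption.
Qed.

(** The l1 norm, because its submultiplicativity only uses the triangle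
    inequality. *)
Definition Hnorm1 (p : H) : R := Rabs (Hre p) + Rabs (Hi p) + Rabs (Hj p) + Rabs (Hk p).
Definition Hsummable (u : nat -> H) : Prop := ex_series (fun n => Hnorm1 (u n)).

Lemma Hsummable_coords (u : nat -> H) : Hsummable u ->
  ex_series (fun n => Rabs (Hre (u n))) /\ ex_series (fun n => Rabs (Hi (u n))) /\
  ex_series (fun n => Rabs (Hj (u n))) /\ ex_series (fun n => Rabs (Hk (u n))).
Proof.
intros su.
repeat split; apply (ex_series_le (V := R_CompleteNormedModule) _ (fun n => Hnorm1 (u n))); try exact su;
  intros n; unfold norm; simpl; unfold abs; simpl; rewrite Rabs_Rabsolu; unfold Hnorm1;
  pose proof (Rabs_pos (Hre (u n))); pose proof (Rabs_pos (Hi (u n)));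
  pose proof (Rabs_pos (Hj (u n))); pose proof (Rabs_pos (Hk (u n))); lra.
Qed.

Lemma Hsummable_is_Hseries (u : nat -> H) : Hsummable u -> is_Hseries u (Hseries u).
Proof.
intros su; destruct (Hsummable_coords u su) as (h0 & h1 & h2 & h3).
repeat split; apply Series_correct, ex_series_Rabs; assumption.
Qed.

Lemma is_Hseries_plus (u v : nat -> H) (l m : H) :
  is_Hseries u l -> is_Hseries v m -> is_Hseries (fun n => plus (u n) (v n)) (plus l m).
Proof.
intros (a0 & a1 & a2 & a3) (b0 & b1 & b2 & b3).
destruct l as [[[l0 l1] l2] l3], m as [[[m0 m1] m2] m3].
repeat split; [generalize (is_series_plus _ _ _ _ a0 b0) | generalize (is_series_plus _ _ _ _ a1 b1) |
  generalize (is_series_plus _ _ _ _ a2 b2) | generalize (is_series_plus _ _ _ _ a3 b3)];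
  apply is_series_ext; intros n; cbv beta;
  destruct (u n) as [[[? ?] ?] ?], (v n) as [[[? ?] ?] ?]; reflexivity.
Qed.

Lemma is_Hseries_opp (u : nat -> H) (l : H) :
  is_Hseries u l -> is_Hseries (fun n => opp (u n)) (opp l).
Proof.
intros (a0 & a1 & a2 & a3); destruct l as [[[l0 l1] l2] l3].
repeat split; [generalize (is_series_opp _ _ a0) | generalize (is_series_opp _ _ a1) |
  generalize (is_series_opp _ _ a2) | generalize (is_series_opp _ _ a3)];
  apply is_series_ext; intros n; cbv beta; destruct (u n) as [[[? ?] ?] ?]; reflexivity.
Qed.

Lemma is_Hseries_ext (u v : nat -> H) (l : H) :
  (forall n, u n = v n) -> is_Hseries u l -> is_Hseries v l.
Proof.
intros E (h0 & h1 & h2 & h3); repeat split;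
  (eapply is_series_ext; [intros n; rewrite <- E; reflexivity | assumption]).
Qed.

(** Each coordinate of a quaternion product is such a four-term combination,
    with signs [s1], [s2], [s3]. *)
Lemma is_series_comb4 (f : nat -> R) (s1 s2 s3 : R) (u0 u1 u2 u3 : nat -> R) (l0 l1 l2 l3 l : R) :
  is_series u0 l0 -> is_series u1 l1 -> is_series u2 l2 -> is_series u3 l3 ->
  (forall n, u0 n + s1 * u1 n + s2 * u2 n + s3 * u3 n = f n) ->
  l0 + s1 * l1 + s2 * l2 + s3 * l3 = l ->
  is_series f l.
Proof.
intros h0 h1 h2 h3 E <-.
apply (is_series_ext _ _ _ E).
exact (is_series_plus _ _ _ _ (is_series_plus _ _ _ _ (is_series_plus _ _ _ _ h0
  (is_series_scal s1 _ _ h1)) (is_series_scal s2 _ _ h2)) (is_series_scal s3 _ _ h3)).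
Qed.

Lemma is_Hseries_Hmul_l (J : H) (u : nat -> H) (l : H) :
  is_Hseries u l -> is_Hseries (fun n => Hmul J (u n)) (Hmul J l).
Proof.
intros (a0 & a1 & a2 & a3); destruct J as [[[j0 j1] j2] j3], l as [[[l0 l1] l2] l3].
pose proof (fun x => is_series_scal x _ _ a0) as b0.
pose proof (fun x => is_series_scal x _ _ a1) as b1.
pose proof (fun x => is_series_scal x _ _ a2) as b2.
pose proof (fun x => is_series_scal x _ _ a3) as b3.
repeat split; [
    apply (is_series_comb4 _ (-1) (-1) (-1) _ _ _ _ _ _ _ _ _ (b0 j0) (b1 j1) (b2 j2) (b3 j3))
  | apply (is_series_comb4 _ 1 1 (-1) _ _ _ _ _ _ _ _ _ (b1 j0) (b0 j1) (b3 j2) (b2 j3))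
  | apply (is_series_comb4 _ (-1) 1 1 _ _ _ _ _ _ _ _ _ (b2 j0) (b3 j1) (b0 j2) (b1 j3))
  | apply (is_series_comb4 _ 1 (-1) 1 _ _ _ _ _ _ _ _ _ (b3 j0) (b2 j1) (b1 j2) (b0 j3)) ];
  try (intros n; cbv beta; destruct (u n) as [[[? ?] ?] ?]);
  simpl; unfold scal; simpl; unfold mult; simpl; ring.
Qed.

Lemma Hcoord_sum (phi : H -> R) (F : nat -> H) (u0 u1 u2 u3 : nat -> R) (s1 s2 s3 : R) (n : nat) :
  (forall p q, phi (plus p q) = phi p + phi q) ->
  (forall k, u0 k + s1 * u1 k + s2 * u2 k + s3 * u3 k = phi (F k)) ->
  sum_f_R0 u0 n + s1 * sum_f_R0 u1 n + s2 * sum_f_R0 u2 n + s3 * sum_f_R0 u3 n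
  = phi (sum_n F n).
Proof.
intros lin E; induction n as [| n IH]; [rewrite sum_O; apply E |].
rewrite sum_Sn, lin, <- IH, <- E; simpl; ring.
Qed.

(** Mertens' theorem in [H], from the real one applied to the sixteen products
    of coordinates. *)
Lemma is_Hseries_cauchy (u v : nat -> H) :
  Hsummable u -> Hsummable v ->
  is_Hseries (fun n => sum_n (fun k => Hmul (u k) (v (n - k)%nat)) n) (Hmul (Hseries u) (Hseries v)).
Proof.
intros su sv.
destruct (Hsummable_is_Hseries u su) as (a0 & a1 & a2 & a3).
destruct (Hsummable_is_Hseries v sv) as (b0 & b1 & b2 & b3).
destruct (Hsummable_coords u su) as (c0 & c1 & c2 & c3).
destruct (Hsummable_coords v sv) as (d0 & d1 & d2 & d3).
assert (lin : forall phi, (phi = Hre \/ phi = Hi \/ phi = Hj \/ phi = Hk) ->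
  forall p q : H, phi (plus p q) = phi p + phi q).
{ intros phi hphi [[[? ?] ?] ?] [[[? ?] ?] ?]; now destruct hphi as [-> | [-> | [-> | ->]]]. }
destruct (Hseries u) as [[[l0 l1] l2] l3], (Hseries v) as [[[m0 m1] m2] m3].
cbn [Hre Hi Hj Hk] in *.
assert (term : forall k n, exists a b c d a' b' c' d',
   u k = (a, b, c, d) /\ v (n - k)%nat = (a', b', c', d')).
{ intros k n; destruct (u k) as [[[? ?] ?] ?], (v (n - k)%nat) as [[[? ?] ?] ?]; now repeat eexists. }
repeat split.
- refine (is_series_comb4 _ (-1) (-1) (-1) _ _ _ _ _ _ _ _ _ (is_series_mult _ _ _ _ a0 b0 c0 d0)
   (is_series_mult _ _ _ _ a1 b1 c1 d1) (is_series_mult _ _ _ _ a2 b2 c2 d2)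
   (is_series_mult _ _ _ _ a3 b3 c3 d3) _ _); [| cbn [Hmul Hre]; ring].
  intros n; apply Hcoord_sum; [apply lin; tauto |]; intros k.
  destruct (term k n) as (? & ? & ? & ? & ? & ? & ? & ? & -> & ->); simpl; ring.
- refine (is_series_comb4 _ 1 1 (-1) _ _ _ _ _ _ _ _ _ (is_series_mult _ _ _ _ a0 b1 c0 d1)
   (is_series_mult _ _ _ _ a1 b0 c1 d0) (is_series_mult _ _ _ _ a2 b3 c2 d3)
   (is_series_mult _ _ _ _ a3 b2 c3 d2) _ _); [| cbn [Hmul Hi]; ring].
  intros n; apply Hcoord_sum; [apply lin; tauto |]; intros k.
  destruct (term k n) as (? & ? & ? & ? & ? & ? & ? & ? & -> & ->); simpl; ring.
- refine (is_series_comb4 _ (-1) 1 1 _ _ _ _ _ _ _ _ _ (is_series_mult _ _ _ _ a0 b2 c0 d2)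
   (is_series_mult _ _ _ _ a1 b3 c1 d3) (is_series_mult _ _ _ _ a2 b0 c2 d0)
   (is_series_mult _ _ _ _ a3 b1 c3 d1) _ _); [| cbn [Hmul Hj]; ring].
  intros n; apply Hcoord_sum; [apply lin; tauto |]; intros k.
  destruct (term k n) as (? & ? & ? & ? & ? & ? & ? & ? & -> & ->); simpl; ring.
- refine (is_series_comb4 _ 1 (-1) 1 _ _ _ _ _ _ _ _ _ (is_series_mult _ _ _ _ a0 b3 c0 d3)
   (is_series_mult _ _ _ _ a1 b2 c1 d2) (is_series_mult _ _ _ _ a2 b1 c2 d1)
   (is_series_mult _ _ _ _ a3 b0 c3 d0) _ _); [| cbn [Hmul Hk]; ring].
  intros n; apply Hcoord_sum; [apply lin; tauto |]; intros k.
  destruct (term k n) as (? & ? & ? & ? & ? & ? & ? & ? & -> & ->); simpl; ring.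
Qed.

Definition HCnorm1 (w : HC) : R := Hnorm1 (fst w) + Hnorm1 (snd w).

Lemma Hnorm1_pos (p : H) : 0 <= Hnorm1 p.
Proof.
unfold Hnorm1; pose proof (Rabs_pos (Hre p)); pose proof (Rabs_pos (Hi p));
pose proof (Rabs_pos (Hj p)); pose proof (Rabs_pos (Hk p)); lra.
Qed.

Lemma Hnorm1_plus (p q : H) : Hnorm1 (plus p q) <= Hnorm1 p + Hnorm1 q.
Proof.
destruct p as [[[a b] c] d], q as [[[a' b'] c'] d']; rewrite HplusE.
unfold Hnorm1; cbn [Hre Hi Hj Hk].
pose proof (Rabs_triang a a'); pose proof (Rabs_triang b b').
pose proof (Rabs_triang c c'); pose proof (Rabs_triang d d'); lra.
Qed.

Lemma Hnorm1_opp (p : H) : Hnorm1 (opp p) = Hnorm1 p.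
Proof.
destruct p as [[[a b] c] d]; rewrite HoppE; unfold Hnorm1; cbn [Hre Hi Hj Hk].
now rewrite !Rabs_Ropp.
Qed.

Lemma Hnorm1_scal (x : R) (p : H) : Hnorm1 (scal x p) = Rabs x * Hnorm1 p.
Proof.
destruct p as [[[a b] c] d]; rewrite HscalE; unfold Hnorm1; cbn [Hre Hi Hj Hk].
rewrite !Rabs_mult; ring.
Qed.

Lemma Hnorm1_mul (p q : H) : Hnorm1 (Hmul p q) <= Hnorm1 p * Hnorm1 q.
Proof.
destruct p as [[[a b] c] d], q as [[[a' b'] c'] d'].
unfold Hnorm1; cbn [Hmul Hre Hi Hj Hk].
assert (T : forall x y z t, Rabs (x + y + z + t) <= Rabs x + Rabs y + Rabs z + Rabs t).
{ intros x y z t; pose proof (Rabs_triang (x + y + z) t); pose proof (Rabs_triang (x + y) z).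
  pose proof (Rabs_triang x y); lra. }
pose proof (T (a * a') (- (b * b')) (- (c * c')) (- (d * d'))) as T0.
pose proof (T (a * b') (b * a') (c * d') (- (d * c'))) as T1.
pose proof (T (a * c') (- (b * d')) (c * a') (d * b')) as T2.
pose proof (T (a * d') (b * c') (- (c * b')) (d * a')) as T3.
rewrite ?Rabs_Ropp, !Rabs_mult in *; unfold Rminus.
eapply Rle_trans;
  [exact (Rplus_le_compat _ _ _ _ (Rplus_le_compat _ _ _ _ (Rplus_le_compat _ _ _ _ T0 T1) T2) T3) |].
right; ring.
Qed.

Lemma HCnorm1_mul (u v : HC) : HCnorm1 (HCmul u v) <= HCnorm1 u * HCnorm1 v.
Proof.
destruct u as [p q], v as [p' q']; unfold HCnorm1; cbn [HCmul fst snd].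
pose proof (Hnorm1_plus (Hmul p p') (opp (Hmul q q'))) as T1.
rewrite Hnorm1_opp in T1.
pose proof (Hnorm1_plus (Hmul p q') (Hmul q p')) as T2.
eapply Rle_trans; [exact (Rplus_le_compat _ _ _ _ T1 T2) |].
pose proof (Hnorm1_mul p p'); pose proof (Hnorm1_mul q q').
pose proof (Hnorm1_mul p q'); pose proof (Hnorm1_mul q p').
rewrite Rmult_plus_distr_l, !Rmult_plus_distr_r; lra.
Qed.

Lemma HCnorm1_pow (w : HC) (n : nat) : HCnorm1 (HCpow w n) <= HCnorm1 w ^ n.
Proof.
induction n as [| n IH]; cbn [HCpow pow].
- change (zero : H) with ((0, 0, 0, 0) : H).
  unfold HCnorm1, Hnorm1; cbn [H_of_R fst snd Hre Hi Hj Hk]; rewrite !Rabs_R0, Rabs_R1; lra.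
- eapply Rle_trans; [apply HCnorm1_mul |]; apply Rmult_le_compat_l; [| exact IH].
  unfold HCnorm1; pose proof (Hnorm1_pos (fst w)); pose proof (Hnorm1_pos (snd w)); lra.
Qed.

Lemma HCexp_term_summable (w : HC) :
  Hsummable (fun n => fst (HCexp_term w n)) /\ Hsummable (fun n => snd (HCexp_term w n)).
Proof.
assert (ex : ex_series (fun n => / INR (fact n) * HCnorm1 w ^ n)).
{ exists (exp (HCnorm1 w)); eapply is_series_ext; [| exact (is_exp_Reals (HCnorm1 w))].
  intros n; simpl; rewrite <- pow_n_pow; apply Rmult_comm. }
assert (bound : forall n, Hnorm1 (fst (HCexp_term w n)) + Hnorm1 (snd (HCexp_term w n))
  <= / INR (fact n) * HCnorm1 w ^ n).
{ intros n; unfold HCexp_term; pose proof (HCnorm1_pow w n) as P.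
  destruct (HCpow w n) as [p q]; rewrite HCscalE; unfold HCnorm1 at 1 in P; cbn [fst snd] in *.
  pose proof (Rinv_0_lt_compat _ (INR_fact_lt_0 n)).
  rewrite !Hnorm1_scal, Rabs_pos_eq, <- Rmult_plus_distr_l by lra.
  apply Rmult_le_compat_l; lra. }
split; apply (ex_series_le (V := R_CompleteNormedModule) _ _) with (2 := ex); intros n;
  (eapply Rle_trans; [right; apply Rabs_pos_eq, Hnorm1_pos |]);
  (eapply Rle_trans; [| exact (bound n)]).
- rewrite <- Rplus_0_r at 1; apply Rplus_le_compat_l, Hnorm1_pos.
- rewrite <- Rplus_0_l at 1; apply Rplus_le_compat_r, Hnorm1_pos.
Qed.

Definition HCexp (w : HC) : HC :=
  (Hseries (fun n => fst (HCexp_term w n)), Hseries (fun n => snd (HCexp_term w n))).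

Lemma HCexp_plus (u v : HC) :
  HCmul u v = HCmul v u -> HCexp (plus u v) = HCmul (HCexp u) (HCexp v).
Proof.
intros uv.
destruct (HCexp_term_summable u) as [up uq], (HCexp_term_summable v) as [vp vq].
assert (fstsum : forall (f : nat -> HC) n, fst (sum_n f n) = sum_n (fun k => fst (f k)) n).
{ intros f n; induction n as [| n IH]; [now rewrite !sum_O | now rewrite !sum_Sn, <- IH]. }
assert (sndsum : forall (f : nat -> HC) n, snd (sum_n f n) = sum_n (fun k => snd (f k)) n).
{ intros f n; induction n as [| n IH]; [now rewrite !sum_O | now rewrite !sum_Sn, <- IH]. }
assert (sumopp : forall (f : nat -> H) n, opp (sum_n f n) = sum_n (fun k => opp (f k)) n).
{ intros f n; induction n as [| n IH]; [now rewrite !sum_O | now rewrite !sum_Sn, H_opp_plus, IH]. }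
unfold HCexp, HCmul; f_equal; apply is_Hseries_unique.
- eapply is_Hseries_ext;
    [| exact (is_Hseries_plus _ _ _ _ (is_Hseries_cauchy _ _ up vp)
                (is_Hseries_opp _ _ (is_Hseries_cauchy _ _ uq vq)))].
  intros n; cbv beta; rewrite sumopp, <- sum_n_plus, HCexp_term_plus, fstsum by exact uv.
  apply sum_n_ext; intros k.
  now destruct (HCexp_term u k), (HCexp_term v (n - k)).
- eapply is_Hseries_ext;
    [| exact (is_Hseries_plus _ _ _ _ (is_Hseries_cauchy _ _ up vq) (is_Hseries_cauchy _ _ uq vp))].
  intros n; cbv beta; rewrite <- sum_n_plus, HCexp_term_plus, sndsum by exact uv.
  apply sum_n_ext; intros k.
  now destruct (HCexp_term u k), (HCexp_term v (n - k)).
Qed.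

Lemma HCexp_bar (w : HC) : HCexp (HCbar w) = HCbar (HCexp w).
Proof.
assert (E : forall n, HCexp_term (HCbar w) n = HCbar (HCexp_term w n)).
{ intros n; unfold HCexp_term.
  replace (HCpow (HCbar w) n) with (HCbar (HCpow w n)).
  - destruct (HCpow w n) as [p q]; HC_ring.
  - induction n as [| n IH]; cbn [HCpow]; [| now rewrite HCbar_mul, IH].
    unfold H_of_R; change (zero : H) with ((0, 0, 0, 0) : H); HC_ring. }
destruct (HCexp_term_summable w) as [sp sq].
unfold HCexp; cbn [HCbar]; f_equal; apply is_Hseries_unique.
- destruct (Hsummable_is_Hseries _ sp) as (h0 & h1 & h2 & h3); repeat split;
    (eapply is_series_ext; [| eassumption]);
    intros n; rewrite E; now destruct (HCexp_term w n).
- destruct (is_Hseries_opp _ _ (Hsummable_is_Hseries _ sq)) as (h0 & h1 & h2 & h3); repeat split;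
    (eapply is_series_ext; [| eassumption]);
    intros n; cbv beta; rewrite E; now destruct (HCexp_term w n).
Qed.

(** * Slice functions and their stem functions *)

Lemma stem_congr (D : C -> Prop) (F G : C -> HC) :
  conj_invariant D -> (forall z, D z -> G z = F z) -> stem D F -> stem D G.
Proof.
intros cD E sF z Dz; rewrite !E by auto; now apply sF.
Qed.

Lemma stem_HCmul (D : C -> Prop) (F G : C -> HC) :
  stem D F -> stem D G -> stem D (fun z => HCmul (F z) (G z)).
Proof. intros sF sG z Dz; now rewrite sF, sG, HCbar_mul. Qed.

Lemma HCbar_plus (u v : HC) : HCbar (plus u v) = plus (HCbar u) (HCbar v).
Proof. HC_ring. Qed.

Lemma induces_congr (D : C -> Prop) (F : C -> HC) (f g : H -> H) :
  (forall q, Omega D q -> g q = f q) -> induces D F f -> induces D F g.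
Proof.
intros E iF a b J Dz hJ; rewrite E by (now exists a, b, J); now apply iF.
Qed.

Lemma induces_eq (D : C -> Prop) (F G : C -> HC) (f g : H -> H) :
  induces D F f -> induces D G g -> (forall z, D z -> F z = G z) ->
  forall q, Omega D q -> f q = g q.
Proof.
intros iF iG E q (a & b & J & Dz & hJ & ->).
now rewrite iF, iG, E by assumption.
Qed.

Lemma induces_stem_congr (D : C -> Prop) (F G : C -> HC) (f : H -> H) :
  (forall z, D z -> G z = F z) -> induces D F f -> induces D G f.
Proof. intros E iF a b J Dz hJ; rewrite E by exact Dz; now apply iF. Qed.

Lemma induces_plus (D : C -> Prop) (F G : C -> HC) (f g : H -> H) :
  induces D F f -> induces D G g ->
  induces D (fun z => plus (F z) (G z)) (fun q => plus (f q) (g q)).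
Proof.
intros iF iG a b J Dz hJ; rewrite iF, iG by assumption.
generalize (F (a, b)) (G (a, b)); clear; intros u v; HC_ring.
Qed.

(** Pointwise multiplication by a slice-preserving function is induced by the
    product of the stem functions: the values of [A] are real, so they commute
    with the imaginary unit [J]. *)
Lemma induces_real_mul (D : C -> Prop) (A G : C -> HC) (f g : H -> H) :
  (forall z, D z -> Hreal (fst (A z)) /\ Hreal (snd (A z))) ->
  induces D A f -> induces D G g ->
  induces D (fun z => HCmul (A z) (G z)) (fun q => Hmul (f q) (g q)).
Proof.
intros rA iA iG a b J Dz hJ; rewrite iA, iG by assumption.
destruct (rA _ Dz) as [[x hx] [y hy]].
rewrite (surjective_pairing (A (a, b))), hx, hy.
destruct (im_unitE J hJ) as (j1 & j2 & j3 & -> & n1).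
assert (e1 : j1 ^ 2 = 1 - j2 ^ 2 - j3 ^ 2) by lra.
generalize (G (a, b)); clear - e1; intros v; unfold H_of_R; HC_ring; ring [e1].
Qed.

Lemma star_induced (D : C -> Prop) (F G : C -> HC) (f g : H -> H) :
  conj_invariant D -> stem D F -> induces D F f -> stem D G -> induces D G g ->
  induces D (fun z => HCmul (F z) (G z)) (star D f g).
Proof.
intros cD sF iF sG iG.
pose proof (stem_of_spec D F f sF iF) as EF; pose proof (stem_of_spec D G g sG iG) as EG.
assert (E : forall z, D z -> HCmul (stem_of D f z) (stem_of D g z) = HCmul (F z) (G z))
  by (intros z Dz; now rewrite EF, EG).
apply (induces_stem_congr D (fun z => HCmul (stem_of D f z) (stem_of D g z)));
  [intros z Dz; now rewrite E |].
apply induces_slice; [exact cD |].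
apply (stem_congr D (fun z => HCmul (F z) (G z))); [exact cD | exact E | now apply stem_HCmul].
Qed.

Lemma svec_induced (D : C -> Prop) (F : C -> HC) (f : H -> H) :
  conj_invariant D -> stem D F -> induces D F f ->
  induces D (fun z => (Him (fst (F z)), Him (snd (F z)))) (svec D f).
Proof.
intros cD sF iF.
pose proof (stem_of_spec D F f sF iF) as EF.
assert (ic : induces D (fun z => (Hconj (fst (F z)), Hconj (snd (F z)))) (sconj D f)).
{ set (G := fun z => (Hconj (fst (stem_of D f z)), Hconj (snd (stem_of D f z)))).
  assert (EG : forall z, D z -> G z = (Hconj (fst (F z)), Hconj (snd (F z))))
    by (intros z Dz; unfold G; now rewrite EF).
  apply (induces_stem_congr D G); [intros z Dz; now rewrite EG |].
  apply induces_slice; [exact cD |].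
  apply (stem_congr D _ G cD EG); intros z Dz; cbv beta; rewrite sF by exact Dz.
  destruct (F z) as [[[[? ?] ?] ?] [[[? ?] ?] ?]]; cbn [HCbar fst snd].
  rewrite HoppE; cbn [Hconj HCbar]; now rewrite HoppE. }
intros a b J Dz hJ; unfold svec; rewrite iF, ic by assumption; cbv beta.
destruct (im_unitE J hJ) as (j1 & j2 & j3 & -> & _).
destruct (F (a, b)) as [[[[? ?] ?] ?] [[[? ?] ?] ?]]; cbn [fst snd Hconj Him Hmul].
rewrite !HplusE, HminusE, HscalE; apply H_eq; field.
Qed.

Lemma star_pow_induced (D : C -> Prop) (F : C -> HC) (f : H -> H) (n : nat) :
  conj_invariant D -> stem D F -> induces D F f ->
  stem D (fun z => HCpow (F z) n) /\ induces D (fun z => HCpow (F z) n) (star_pow D f n).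
Proof.
intros cD sF iF; induction n as [| n [sn iN]]; cbn [HCpow star_pow].
- split.
  + intros z _; unfold H_of_R; change (zero : H) with ((0, 0, 0, 0) : H); HC_ring.
  + intros a b J _ _; unfold H_of_R; change (zero : H) with ((0, 0, 0, 0) : H); HC_ring.
- split; [now apply stem_HCmul | now apply star_induced].
Qed.

Lemma exp_star_induced (D : C -> Prop) (F : C -> HC) (f : H -> H) :
  conj_invariant D -> stem D F -> induces D F f ->
  stem D (fun z => HCexp (F z)) /\ induces D (fun z => HCexp (F z)) (exp_star D f).
Proof.
intros cD sF iF; split.
{ intros z Dz; now rewrite sF, HCexp_bar. }
intros a b J Dz hJ; unfold exp_star; apply is_Hseries_unique.
destruct (HCexp_term_summable (F (a, b))) as [sp sq].
pose proof (is_Hseries_plus _ _ _ _ (Hsummable_is_Hseries _ sp)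
  (is_Hseries_Hmul_l J _ _ (Hsummable_is_Hseries _ sq))) as S.
refine (is_Hseries_ext _ _ _ _ S); intros n; cbv beta.
rewrite (proj2 (star_pow_induced D F f n cD sF iF)) by assumption.
unfold HCexp_term; generalize (HCpow (F (a, b)) n); clear; intros w; HC_ring.
Qed.

(** For [phi] one of [Hre], [Hi], [Hj], [Hk], a coordinate of the
    identification [HC_coords] of [HC] with [C^4]. *)
Definition HCcoord (phi : H -> R) (w : HC) : C := (phi (fst w), phi (snd w)).

Lemma ex_derive_fst {U V : NormedModule C_AbsRing} (f : C -> prod_NormedModule C_AbsRing U V) (z : C) :
  ex_derive f z -> ex_derive (fun x => fst (f x)) z.
Proof.
intros [l hl]; exists (fst l).
eapply filterdiff_ext_lin;
  [apply (filterdiff_comp' (U := AbsRing_NormedModule C_AbsRing) f fst z _ fst hl);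
    apply filterdiff_linear, is_linear_fst |].
intros y; reflexivity.
Qed.

Lemma ex_derive_snd {U V : NormedModule C_AbsRing} (f : C -> prod_NormedModule C_AbsRing U V) (z : C) :
  ex_derive f z -> ex_derive (fun x => snd (f x)) z.
Proof.
intros [l hl]; exists (snd l).
eapply filterdiff_ext_lin;
  [apply (filterdiff_comp' (U := AbsRing_NormedModule C_AbsRing) f snd z _ snd hl);
    apply filterdiff_linear, is_linear_snd |].
intros y; reflexivity.
Qed.

Lemma holomorphic_coords (D : C -> Prop) (F : C -> HC) (z : C) :
  holomorphic D F -> D z ->
  ex_derive (fun x => HCcoord Hre (F x)) z /\ ex_derive (fun x => HCcoord Hi (F x)) z /\
  ex_derive (fun x => HCcoord Hj (F x)) z /\ ex_derive (fun x => HCcoord Hk (F x)) z.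
Proof.
intros hF Dz; specialize (hF z Dz).
pose proof (ex_derive_fst _ _ hF) as h1; pose proof (ex_derive_fst _ _ h1) as h2.
repeat split; [generalize (ex_derive_fst _ _ h2) | generalize (ex_derive_snd _ _ h2) |
  generalize (ex_derive_snd _ _ h1) | generalize (ex_derive_snd _ _ hF)];
  apply ex_derive_ext; intros x; unfold HCcoord;
  now destruct (F x) as [[[[? ?] ?] ?] [[[? ?] ?] ?]].
Qed.

(** The commutator in [HC] is twice the cross product of the vector parts, whose
    coordinates are these minors. *)
Lemma HCmul_commute (u v : HC) :
  (HCcoord Hi u * HCcoord Hj v - HCcoord Hj u * HCcoord Hi v = 0)%C ->
  (HCcoord Hj u * HCcoord Hk v - HCcoord Hk u * HCcoord Hj v = 0)%C ->
  (HCcoord Hk u * HCcoord Hi v - HCcoord Hi u * HCcoord Hk v = 0)%C ->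
  HCmul u v = HCmul v u.
Proof.
destruct u as [[[[? ?] ?] ?] [[[? ?] ?] ?]], v as [[[[? ?] ?] ?] [[[? ?] ?] ?]].
unfold HCcoord; cbn [fst snd Hi Hj Hk].
unfold Cminus, Cplus, Copp, Cmult, RtoC; cbn [fst snd].
intros h1 h2 h3; injection h1 as; injection h2 as; injection h3 as.
HC_ring; lra.
Qed.

(** * Commuting stem functions *)

Lemma ex_derive_minor (p q r s : C -> C) (z : C) :
  ex_derive p z -> ex_derive q z -> ex_derive r z -> ex_derive s z ->
  ex_derive (fun x => p x * q x - r x * s x)%C z.
Proof.
intros [p' hp] [q' hq] [r' hr] [s' hs].
apply is_derive_C_AbsRing in hp, hq, hr, hs.
eexists; apply is_derive_C_AbsRing.
apply (is_derive_minus (V := AbsRing_NormedModule C_AbsRing)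
  (fun x => p x * q x)%C (fun x => r x * s x)%C).
- exact (is_derive_mult p q z _ _ hp hq Cmult_comm).
- exact (is_derive_mult r s z _ _ hr hs Cmult_comm).
Qed.

Lemma minor_holomorphic (D : C -> Prop) (F G : C -> HC) (phi psi : H -> R) (z : C) :
  (phi = Hi \/ phi = Hj \/ phi = Hk) -> (psi = Hi \/ psi = Hj \/ psi = Hk) ->
  holomorphic D F -> holomorphic D G -> D z ->
  ex_derive (fun x => HCcoord phi (F x) * HCcoord psi (G x)
                      - HCcoord psi (F x) * HCcoord phi (G x))%C z.
Proof.
intros hphi hpsi hF hG Dz.
destruct (holomorphic_coords D F z hF Dz) as (_ & f1 & f2 & f3).
destruct (holomorphic_coords D G z hG Dz) as (_ & g1 & g2 & g3).
apply ex_derive_minor;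
  destruct hphi as [-> | [-> | ->]]; destruct hpsi as [-> | [-> | ->]]; assumption.
Qed.

Lemma HCcoord_real_mul (phi : H -> R) (u v : HC) :
  (phi = Hi \/ phi = Hj \/ phi = Hk) ->
  Hreal (fst u) -> Hreal (snd u) ->
  HCcoord phi (HCmul u (Him (fst v), Him (snd v))) = (HCcoord Hre u * HCcoord phi v)%C.
Proof.
intros hphi [x hx] [y hy]; destruct u as [p q]; cbn [fst snd] in *; subst p q.
destruct v as [[[[? ?] ?] ?] [[[? ?] ?] ?]].
unfold HCcoord, H_of_R; cbn [fst snd Him HCmul Hmul Hre]; rewrite HminusE, HplusE.
destruct hphi as [-> | [-> | ->]]; cbn [fst snd Hi Hj Hk];
  unfold Cmult; cbn [fst snd]; f_equal; ring.
Qed.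

(** In complex coordinates the dependence reads
    [a * f_i + b * g_i = 0] for the three coordinates [f_i], [g_i] of the vector
    parts.  By Cramer's rule, [a] and [b] annihilate the minors
    [f_i * g_j - f_j * g_i].  One of [a], [b] is not identically zero, and being
    holomorphic it can be cancelled even though it may have zeros
    ([holomorphic_zero_divisor]). *)
Lemma dependent_commute (D : C -> Prop) (F G : C -> HC) (f g : H -> H) :
  circular_domain D ->
  stem D F -> holomorphic D F -> induces D F f ->
  stem D G -> holomorphic D G -> induces D G g ->
  sp_dependent D (svec D f) (svec D g) ->
  forall z, D z -> HCmul (F z) (G z) = HCmul (G z) (F z).
Proof.
intros cd sF hF iF sG hG iG.
intros (alpha & beta & (A & sA & hA & iA & rA) & (B & sB & hB & iB & rB) & nz & dep).
pose proof (proj1 cd) as cD.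
assert (rel : forall phi z, (phi = Hi \/ phi = Hj \/ phi = Hk) -> D z ->
  (HCcoord Hre (A z) * HCcoord phi (F z) + HCcoord Hre (B z) * HCcoord phi (G z) = 0)%C).
{ intros phi z hphi Dz.
  assert (E : plus (HCmul (A z) (Him (fst (F z)), Him (snd (F z))))
                   (HCmul (B z) (Him (fst (G z)), Him (snd (G z)))) = (zero, zero)).
  { refine (stem_unique D (fun z => plus (HCmul (A z) (Him (fst (F z)), Him (snd (F z))))
        (HCmul (B z) (Him (fst (G z)), Him (snd (G z))))) (fun _ => (zero, zero)) (fun _ => zero) _ _ z Dz).
    - apply (induces_congr D _ (fun q => plus (Hmul (alpha q) (svec D f q)) (Hmul (beta q) (svec D g q)))).
      + intros q Oq; symmetry; now apply dep.
      + apply induces_plus; apply induces_real_mul; auto using svec_induced.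
    - intros a b J _ _; change (zero : H) with ((0, 0, 0, 0) : H); HC_ring. }
  destruct (rA z Dz) as [ra1 ra2], (rB z Dz) as [rb1 rb2].
  rewrite <- !HCcoord_real_mul by assumption.
  revert E; generalize (HCmul (A z) (Him (fst (F z)), Him (snd (F z))))
    (HCmul (B z) (Him (fst (G z)), Him (snd (G z)))).
  intros [[[[? ?] ?] ?] [[[? ?] ?] ?]] [[[[? ?] ?] ?] [[[? ?] ?] ?]].
  rewrite HCplusE, !HplusE; change (zero : H) with ((0, 0, 0, 0) : H); intros e; injection e as.
  unfold HCcoord, Cplus; cbn [fst snd]; destruct hphi as [-> | [-> | ->]];
    cbn [Hi Hj Hk]; apply injective_projections; simpl; assumption. }
assert (sym : forall K : C -> HC, stem D K ->
  forall z, D z -> HCcoord Hre (K (Cconj z)) = Cconj (HCcoord Hre (K z))).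
{ intros K sK z Dz; rewrite sK by exact Dz.
  now destruct (K z) as [[[[? ?] ?] ?] [[[? ?] ?] ?]]. }
assert (zero_of : forall (K : C -> HC) k, induces D K k ->
  (forall z, D z -> Hreal (fst (K z)) /\ Hreal (snd (K z))) ->
  (forall z, D z -> HCcoord Hre (K z) = 0) -> forall q, Omega D q -> k q = zero).
{ intros K k iK rK K0 q (a & b & J & Dz & hJ & ->).
  rewrite iK by assumption; destruct (rK _ Dz) as [[x hx] [y hy]].
  specialize (K0 _ Dz); unfold HCcoord in K0; rewrite hx, hy in *.
  injection K0 as -> ->; unfold H_of_R; change (zero : H) with ((0, 0, 0, 0) : H); HC_ring. }
assert (minor : forall phi psi z, (phi = Hi \/ phi = Hj \/ phi = Hk) ->
  (psi = Hi \/ psi = Hj \/ psi = Hk) -> D z ->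
  (HCcoord phi (F z) * HCcoord psi (G z) - HCcoord psi (F z) * HCcoord phi (G z) = 0)%C).
{ intros phi psi z hphi hpsi Dz; revert z Dz.
  assert (cancel : forall K : C -> HC, stem D K -> holomorphic D K ->
    (forall z, D z -> (HCcoord Hre (K z) *
       (HCcoord phi (F z) * HCcoord psi (G z) - HCcoord psi (F z) * HCcoord phi (G z)) = 0)%C) ->
    (exists z, D z /\ HCcoord Hre (K z) <> 0) ->
    forall z, D z ->
      (HCcoord phi (F z) * HCcoord psi (G z) - HCcoord psi (F z) * HCcoord phi (G z) = 0)%C).
  { intros K sK hK zK nK.
    apply (holomorphic_zero_divisor D (fun z => HCcoord Hre (K z))); auto.
    - intros w Dw; apply (holomorphic_coords D K w hK Dw).
    - intros w Dw; now apply (minor_holomorphic D F G). }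
  destruct (classic (exists z, D z /\ HCcoord Hre (A z) <> 0)) as [nA | A0];
    [| destruct (classic (exists z, D z /\ HCcoord Hre (B z) <> 0)) as [nB | B0]].
  - apply (cancel A); try assumption.
    intros w Dw; pose proof (rel phi w hphi Dw) as e1; pose proof (rel psi w hpsi Dw) as e2.
    transitivity ((HCcoord Hre (A w) * HCcoord phi (F w) + HCcoord Hre (B w) * HCcoord phi (G w))
        * HCcoord psi (G w)
      - (HCcoord Hre (A w) * HCcoord psi (F w) + HCcoord Hre (B w) * HCcoord psi (G w))
        * HCcoord phi (G w))%C; [ring |].
    rewrite e1, e2; ring.
  - apply (cancel B); try assumption.
    intros w Dw; pose proof (rel phi w hphi Dw) as e1; pose proof (rel psi w hpsi Dw) as e2.
    transitivity ((HCcoord Hre (A w) * HCcoord psi (F w) + HCcoord Hre (B w) * HCcoord psi (G w))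
        * HCcoord phi (F w)
      - (HCcoord Hre (A w) * HCcoord phi (F w) + HCcoord Hre (B w) * HCcoord phi (G w))
        * HCcoord psi (F w))%C; [ring |].
    rewrite e1, e2; ring.
  - exfalso; apply nz; split.
    + apply (zero_of A alpha iA rA); intros w Dw; apply NNPP; intros n; apply A0; now exists w.
    + apply (zero_of B beta iB rB); intros w Dw; apply NNPP; intros n; apply B0; now exists w. }
intros z Dz; apply HCmul_commute; apply minor; tauto.
Qed.

Lemma real_commute (u v : HC) :
  Hreal (fst u) -> Hreal (snd u) -> HCmul u v = HCmul v u.
Proof.
intros [x hx] [y hy]; destruct u as [p q]; cbn [fst snd] in *; subst p q; unfold H_of_R; HC_ring.
Qed.

(** All operations of the equation are computed on stem functions, where it
    becomes [HCexp_plus] at each point of [D]. *)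
Lemma exp_star_plus (D : C -> Prop) (F G : C -> HC) (f g : H -> H) :
  conj_invariant D -> stem D F -> induces D F f -> stem D G -> induces D G g ->
  (forall z, D z -> HCmul (F z) (G z) = HCmul (G z) (F z)) ->
  forall q, Omega D q -> exp_star D (sadd f g) q = star D (exp_star D f) (exp_star D g) q.
Proof.
intros cD sF iF sG iG FG.
assert (sFG : stem D (fun z => plus (F z) (G z)))
  by (intros z Dz; now rewrite sF, sG, HCbar_plus).
destruct (exp_star_induced D F f cD sF iF) as [seF ieF].
destruct (exp_star_induced D G g cD sG iG) as [seG ieG].
destruct (exp_star_induced D _ (sadd f g) cD sFG (induces_plus D F G f g iF iG)) as [_ ieFG].
apply (induces_eq D _ _ _ _ ieFG (star_induced D _ _ _ _ cD seF ieF seG ieG)).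
intros z Dz; now apply HCexp_plus, FG.
Qed.

Theorem proposition4p3 (D : C -> Prop) (f g : H -> H) :
  circular_domain D ->
  (exists q : H, Omega D q) ->
  slice_regular D f ->
  slice_regular D g ->
  (sp_dependent D (svec D f) (svec D g) ->
     forall q : H, Omega D q ->
       exp_star D (sadd f g) q = star D (exp_star D f) (exp_star D g) q) /\
  (slice_preserving D f \/ slice_preserving D g ->
     forall q : H, Omega D q ->
       exp_star D (sadd f g) q = star D (exp_star D f) (exp_star D g) q).
Proof.
intros cd _ (F & sF & hF & iF) (G & sG & hG & iG); pose proof (proj1 cd) as cD.
split.
- intros dep; apply (exp_star_plus D F G); try assumption.
  now apply (dependent_commute D F G f g).
- intros [(A & sA & hA & iA & rA) | (A & sA & hA & iA & rA)].
  + apply (exp_star_plus D A G); try assumption.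
    intros z Dz; apply real_commute; now apply rA.
  + apply (exp_star_plus D F A); try assumption.
    intros z Dz; symmetry; apply real_commute; now apply rA.
Qed.
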